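(* Let $n\ge2$. The type $B_n$ zigzag algebra $\mathscr{B}_n$ is isomorphic, as an $\mathbb{R}$-algebra, to the invariant subalgebra of the type $A_{2n-1}$ zigzag algebra: $$\mathscr{B}_n\cong_{\mathbb{R}}\mathscr{A}_{2n-1}^{inv},$$ where the invariants are taken under the diagonal $\mathbb{Z}/2$ inside $\mathbb{Z}/2\times\mathbb{Z}/2$, the first factor acting by the symplectic involution $\tau$ (the reflection of the type $A_{2n-1}$ diagram) and the second by the algebraic involution (complex conjugation of coefficients).
   Context: $\mathscr{B}_n$: let $Q_n$ be the quiver with vertices $1,\dots,n$, arrows $(j|j+1):j\to j+1$, $(j+1|j):j+1\to j$ ($1\le j\le n-1$) and loops $ie_j$ at $j$ ($2\le j\le n$). Paths are concatenated left to right and $e_j$ is the constant path. $\mathscr{B}_n$ is the quotient of $\mathbb{R}Q_n$ by: $(j|j-1)(j-1|j)=(j|j+1)(j+1|j)$, $(j-1|j)(j|j+1)=0=(j+1|j)(j|j-1)$ for $2\le j\le n-1$; $(ie_j)^2=-e_j$ ($j\ge2$); $(ie_{j-1})(j-1|j)=(j-1|j)(ie_j)$, $(ie_j)(j|j-1)=(j|j-1)(ie_{j-1})$ ($j\ge3$); $(1|2)(ie_2)(2|1)=0$; $(ie_2)X_2=X_2(ie_2)$ with $X_2=(2|1)(1|2)$. $\mathscr{A}_{2n-1}$: the path algebra over $\mathbb{C}$ of the quiver with vertices $1,\dots,2n-1$ and arrows $(j|j+1)$, $(j+1|j)$, modulo $(j|j+1)(j+1|j)=(j|j-1)(j-1|j)$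 and $(j-1|j)(j|j+1)=0=(j+1|j)(j|j-1)$ for $2\le j\le 2n-2$. The involution $\tau$ is the $\mathbb{C}$-linear algebra automorphism of $\mathscr{A}_{2n-1}$ induced by $j\mapsto 2n-j$ on vertices: $e_j\mapsto e_{2n-j}$, $(j|k)\mapsto(2n-j|2n-k)$. (Under the identification of $\mathscr{A}_{2n-1}$ with $\bigoplus_{i,j}HF^*(L_i,L_j;\mathbb{C})$ for the $A_{2n-1}$-chain of Lagrangian spheres in the type $A_{2n-1}$ Milnor fibre, it comes from the involution $x_d\mapsto-x_d$, which sends $L_{n-j+1}\leftrightarrow L_{n+j-1}$ and fixes $L_n$.) The algebraic involution is the conjugate-linear automorphism fixing all paths and conjugating complex coefficients. The diagonal $\mathbb{Z}/2$ acts by the composite of the two. *)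

(* Defs.v *)
From HB Require Import structures.
From mathcomp Require Import all_boot all_order all_algebra.
From mathcomp Require Import finmap monalg complex boolp reals zify.

Set Implicit Arguments.
Unset Strict Implicit.
Unset Printing Implicit Defensive.

Import GRing.Theory.
Local Open Scope ring_scope.

Record quiver := Quiver {
  vertex : finType;
  arrow : finType;
  src : arrow -> vertex;
  tgt : arrow -> vertex
}.

Section Paths.
Variable Q : quiver.
Implicit Types (v : vertex Q) (s : seq (arrow Q)).

Fixpoint walk v s : bool :=
  if s is a :: s' then (src a == v) && walk (tgt a) s' else true.

Definition walk_end v s := last v [seq tgt a | a <- s].

Definition qpath := {p : vertex Q * seq (arrow Q) | walk p.1 p.2}.
HB.instance Definition _ := SubChoice.on qpath.

Implicit Types p q r : qpath.

Definition pstart p := (sval p).1.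
Definition parrows p := (sval p).2.
Definition pend p := walk_end (pstart p) (parrows p).

Definition path_vertex v : qpath :=
  exist (fun e => walk e.1 e.2) (v, [::]) isT.

Fact path_arrow_subproof (a : arrow Q) : walk (src a) [:: a].
Proof. by rewrite /= eqxx. Qed.
Definition path_arrow (a : arrow Q) : qpath :=
  exist _ (src a, [:: a]) (path_arrow_subproof a).

(* Concatenation is written left to right: first p, then q. *)
Definition pconcat p q : option qpath :=
  if pend p == pstart q then
    (insub (pstart p, parrows p ++ parrows q) : option qpath)
  else None.

Lemma walk_cat v s t : walk v (s ++ t) = walk v s && walk (walk_end v s) t.
Proof. by elim: s v => [|a s IHs] v //=; rewrite IHs andbA. Qed.

Lemma walk_end_cat v s t : walk_end v (s ++ t) = walk_end (walk_end v s) t.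
Proof. by rewrite /walk_end map_cat last_cat. Qed.

Lemma pconcatE p q : omap sval (pconcat p q) =
  if pend p == pstart q then Some (pstart p, parrows p ++ parrows q) else None.
Proof.
rewrite /pconcat; case: eqP => // pq; rewrite insubT //=.
rewrite walk_cat; apply/andP; split; first exact: valP p.
by rewrite -/(pend p) pq; exact: valP q.
Qed.

Lemma omap_valI : injective (omap sval : option qpath -> _).
Proof. exact/inj_omap/val_inj. Qed.

Lemma pconcatA p q r :
  obind (fun t => pconcat t r) (pconcat p q) = obind (pconcat p) (pconcat q r).
Proof.
apply: omap_valI.
have := pconcatE p q; have := pconcatE q r.
case: (pconcat q r) => [t|] /=; case: (pconcat p q) => [u|] //=.
- case: eqP => // qr [tE]; case: eqP => // pq [uE].
  have [tS tA] : pstart t = pstart q /\ parrows t = parrows q ++ parrows r.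
    by rewrite /pstart /parrows tE.
  have [uS uA] : pstart u = pstart p /\ parrows u = parrows p ++ parrows q.
    by rewrite /pstart /parrows uE.
  rewrite !pconcatE {1}/pend uS uA tS tA walk_end_cat catA.
  by rewrite -/(pend p) pq -/(pend q) qr !eqxx.
- case: eqP => // qr [tE]; case: eqP => // pq _.
  have tS : pstart t = pstart q by rewrite /pstart tE.
  by rewrite pconcatE tS; case: eqP.
- case: eqP => // qr _; case: eqP => // pq [uE].
  have [uS uA] : pstart u = pstart p /\ parrows u = parrows p ++ parrows q.
    by rewrite /pstart /parrows uE.
  rewrite pconcatE /pend uS uA walk_end_cat -/(pend p) pq -/(pend q).
  by case: eqP.
Qed.

End Paths.

Arguments path_vertex {Q}.
Arguments path_arrow {Q}.

(* The path algebra K Q: finitely supported K-valued functions on paths.  The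
   module operations are those of {malg K[qpath Q]}; they are locked, like the
   product, only to keep them from being unfolded by unification. *)
Definition pathalg (Q : quiver) (K : comNzRingType) := {malg K[qpath Q]}.
HB.instance Definition _ Q K := Choice.on (pathalg Q K).

HB.lock Definition pa_zero Q K : pathalg Q K := 0 :> {malg K[qpath Q]}.
HB.lock Definition pa_opp Q K (x : pathalg Q K) : pathalg Q K :=
  - (x : {malg K[qpath Q]}).
HB.lock Definition pa_add Q K (x y : pathalg Q K) : pathalg Q K :=
  (x : {malg K[qpath Q]}) + y.
HB.lock Definition pa_scale Q (K : comNzRingType) (c : K) (x : pathalg Q K) :
  pathalg Q K := c *: (x : {malg K[qpath Q]}).

Section PathModule.
Variables (Q : quiver) (K : comNzRingType).
Local Notation A := (pathalg Q K).

Fact pa_addA : associative (@pa_add Q K).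
Proof. by move=> x y z; rewrite pa_add.unlock addrA. Qed.
Fact pa_addC : commutative (@pa_add Q K).
Proof. by move=> x y; rewrite pa_add.unlock addrC. Qed.
Fact pa_add0 : left_id (@pa_zero Q K) (@pa_add Q K).
Proof. by move=> x; rewrite pa_add.unlock pa_zero.unlock add0r. Qed.
Fact pa_addN : left_inverse (@pa_zero Q K) (@pa_opp Q K) (@pa_add Q K).
Proof.
by move=> x; rewrite pa_add.unlock pa_opp.unlock pa_zero.unlock addNr.
Qed.
HB.instance Definition _ := GRing.isZmodule.Build A
  pa_addA pa_addC pa_add0 pa_addN.

Fact pa_scaleA (a b : K) (x : A) :
  pa_scale a (pa_scale b x) = pa_scale (a * b) x.
Proof. by rewrite pa_scale.unlock scalerA. Qed.
Fact pa_scale1 : left_id (1 : K) (@pa_scale Q K).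
Proof. by move=> x; rewrite pa_scale.unlock scale1r. Qed.
Fact pa_scaleDr : right_distributive (@pa_scale Q K) +%R.
Proof.
move=> a x y; rewrite pa_scale.unlock.
by rewrite -[x + y]/(pa_add x y) -[RHS]/(pa_add _ _) pa_add.unlock scalerDr.
Qed.
Fact pa_scaleDl (x : A) : {morph (@pa_scale Q K)^~ x : a b / a + b}.
Proof.
move=> a b; rewrite pa_scale.unlock -[RHS]/(pa_add _ _).
by rewrite pa_add.unlock scalerDl.
Qed.
HB.instance Definition _ := GRing.Zmodule_isLmodule.Build K A
  pa_scaleA pa_scale1 pa_scaleDr pa_scaleDl.

Definition pa_coeff (p : qpath Q) (x : A) : K := x@_p.

Fact pa_coeff_zmod_morphism p : zmod_morphism (pa_coeff p).
Proof.
move=> x y; rewrite -[x - y]/(pa_add x (pa_opp y)) pa_add.unlock pa_opp.unlock.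
exact: mcoeffB.
Qed.
HB.instance Definition _ p := GRing.isZmodMorphism.Build A K (pa_coeff p)
  (pa_coeff_zmod_morphism p).

Lemma pa_coeffZ c (x : A) p : pa_coeff p (c *: x) = c * pa_coeff p x.
Proof.
rewrite -[c *: x]/(pa_scale c x) pa_scale.unlock; exact: mcoeffZ.
Qed.

Lemma pa_eqP (x y : A) : (forall p, pa_coeff p x = pa_coeff p y) -> x = y.
Proof. by move=> xy; apply (proj1 (malgP x y)). Qed.

End PathModule.

HB.lock Definition pa_path (Q : quiver) (K : comNzRingType) (p : qpath Q) :
  pathalg Q K := << p >>.
Arguments pa_path {Q} K p.

HB.lock Definition pa_mul (Q : quiver) (K : comNzRingType)
    (x y : pathalg Q K) : pathalg Q K :=
  \sum_(p <- msupp x) \sum_(q <- msupp y)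
     (pa_coeff p x * pa_coeff q y) *:
       (if pconcat p q is Some r then pa_path K r else 0).
Arguments pa_mul {Q K} x y.

Section PathAlgebra.
Variables (Q : quiver) (K : comNzRingType).
Local Notation A := (pathalg Q K).
Local Notation pa_path := (pa_path K).

Implicit Types (p q r : qpath Q) (x y z : A) (c : K).

Definition pa_vertex (v : vertex Q) : A := pa_path (path_vertex v).
Definition pa_arrow (a : arrow Q) : A := pa_path (path_arrow a).

Definition pa_opath (o : option (qpath Q)) : A :=
  if o is Some p then pa_path p else 0.

Definition pa_one : A := \sum_(v : vertex Q) pa_vertex v.

Lemma pa_coeff_path p q : pa_coeff q (pa_path p) = (p == q)%:R.
Proof. by rewrite pa_path.unlock; exact: mcoeffU. Qed.

Lemma pa_expand x : x = \sum_(p <- msupp x) pa_coeff p x *: pa_path p.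
Proof.
apply: pa_eqP => q; rewrite raddf_sum /=.
under eq_bigr do rewrite pa_coeffZ pa_coeff_path mulr_natr.
have [qx|qx] := boolP (q \in msupp x); last first.
  rewrite [LHS](mcoeff_outdom qx) big1_fset // => p px _.
  by case: eqP => // pq; rewrite -pq px in qx.
by rewrite (big_fsetD1 q) //= eqxx big1_fset ?addr0 // => p;
  rewrite in_fsetD1 => /andP[/negbTE-> _].
Qed.

Lemma pa_ind (P : A -> Prop) : P 0 ->
  (forall c p x, P x -> P (c *: pa_path p + x)) -> forall x, P x.
Proof.
move=> P0 PD x; rewrite [x]pa_expand.
elim: (X in \sum_(i <- X) _) => [|p s IHs]; first by rewrite big_nil.
by rewrite big_cons; exact: PD.
Qed.

Definition pa_ext (V : lmodType K) (f : qpath Q -> V) x : V :=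
  \sum_(p <- msupp x) pa_coeff p x *: f p.

Lemma pa_extw (V : lmodType K) (f : qpath Q -> V) x (D : {fset qpath Q}) :
  fsubset (msupp x) D -> pa_ext f x = \sum_(p <- D) pa_coeff p x *: f p.
Proof.
move=> le; rewrite /pa_ext (big_fset_incl _ le) //= => p _ px.
by rewrite [pa_coeff p x](mcoeff_outdom px) scale0r.
Qed.

Lemma pa_ext_linear (V : lmodType K) (f : qpath Q -> V) : linear (pa_ext f).
Proof.
move=> c x y.
pose D := (msupp (c *: x + y) `|` (msupp x `|` msupp y))%fset.
have Dx : fsubset (msupp x) D.
  by apply/fsubsetP=> p; rewrite !inE => ->; rewrite orbT.
have Dy : fsubset (msupp y) D.
  by apply/fsubsetP=> p; rewrite !inE => ->; rewrite !orbT.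
rewrite !(@pa_extw _ _ _ D) ?fsubsetUl //.
rewrite scaler_sumr -big_split /=; apply: eq_bigr => p _.
by rewrite raddfD /= pa_coeffZ scalerDl scalerA.
Qed.

HB.instance Definition _ (V : lmodType K) (f : qpath Q -> V) :=
  GRing.isLinear.Build K A V *:%R (pa_ext f) (pa_ext_linear f).

Lemma pa_ext_path (V : lmodType K) (f : qpath Q -> V) p :
  pa_ext f (pa_path p) = f p.
Proof.
have le : fsubset (msupp (pa_path p)) [fset p]%fset.
  by rewrite pa_path.unlock msuppU_le.
by rewrite (pa_extw _ le) big_seq_fset1 pa_coeff_path eqxx scale1r.
Qed.

Lemma pa_mulE x y :
  pa_mul x y = pa_ext (fun p => pa_ext (fun q => pa_opath (pconcat p q)) y) x.
Proof.
rewrite pa_mul.unlock; apply: eq_bigr => p _; rewrite scaler_sumr.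
by apply: eq_bigr => q _; rewrite scalerA.
Qed.

Lemma pa_mulEr x y :
  pa_mul x y = pa_ext (fun q => pa_ext (fun p => pa_opath (pconcat p q)) x) y.
Proof.
rewrite pa_mul.unlock exchange_big; apply: eq_bigr => q _; rewrite scaler_sumr.
by apply: eq_bigr => p _; rewrite scalerA mulrC.
Qed.

Lemma pa_mulDl : @left_distributive A A pa_mul +%R.
Proof. by move=> x y z; rewrite !pa_mulE linearD. Qed.

Lemma pa_mulDr : @right_distributive A A pa_mul +%R.
Proof. by move=> x y z; rewrite !pa_mulEr linearD. Qed.

Lemma pa_mulZl c x y : c *: pa_mul x y = pa_mul (c *: x) y.
Proof. by rewrite !pa_mulE linearZ. Qed.

Lemma pa_mulZr c x y : c *: pa_mul x y = pa_mul x (c *: y).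
Proof. by rewrite !pa_mulEr linearZ. Qed.

Lemma pa_mul0l y : pa_mul 0 y = 0. Proof. by rewrite pa_mulE linear0. Qed.

Lemma pa_mul0r x : pa_mul x 0 = 0. Proof. by rewrite pa_mulEr linear0. Qed.

Lemma pa_mul_path p q :
  pa_mul (pa_path p) (pa_path q) = pa_opath (pconcat p q).
Proof. by rewrite pa_mulE !pa_ext_path. Qed.

Lemma pa_lin_eq (V : lmodType K) (f g : A -> V) : linear f -> linear g ->
  (forall p, f (pa_path p) = g (pa_path p)) -> forall x, f x = g x.
Proof.
move=> Lf Lg fg; elim/pa_ind => [|c p x IHx]; last by rewrite Lf Lg fg IHx.
by have [] := (zmod_morphism_linear Lf 0 0, zmod_morphism_linear Lg 0 0);
  rewrite !subrr => -> ->.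
Qed.

Lemma pa_lin_comp (V W : lmodType K) (f : V -> W) (g : A -> V) :
  linear f -> linear g -> linear (f \o g).
Proof. by move=> Lf Lg c x y; rewrite /= Lg Lf. Qed.

Lemma pa_mul_linl y : linear (pa_mul^~ y).
Proof. by move=> c x z; rewrite pa_mulDl -pa_mulZl. Qed.

Lemma pa_mul_linr x : linear (pa_mul x).
Proof. by move=> c y z; rewrite pa_mulDr -pa_mulZr. Qed.

Lemma pa_mulA : @associative A pa_mul.
Proof.
move=> x y z; pose Ll := pa_mul_linl; pose Lr := pa_mul_linr.
apply: (pa_lin_eq (Ll (pa_mul y z)) (pa_lin_comp (Ll z) (Ll y))) => p /=.
apply: (pa_lin_eq (pa_lin_comp (Lr (pa_path p)) (Ll z))
                  (pa_lin_comp (Ll z) (Lr (pa_path p)))) => q /=.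
apply: (pa_lin_eq (pa_lin_comp (Lr (pa_path p)) (Lr (pa_path q)))
                  (Lr (pa_mul (pa_path p) (pa_path q)))) => r /=.
have := pconcatA p q r; rewrite !pa_mul_path.
case: (pconcat q r) => [t|]; case: (pconcat p q) => [u|] /= E.
- by rewrite !pa_mul_path E.
- by rewrite pa_mul_path pa_mul0l -E.
- by rewrite pa_mul_path pa_mul0r E.
- by rewrite pa_mul0l pa_mul0r.
Qed.

Lemma pconcat_vertexl v p :
  pconcat (path_vertex v) p = if v == pstart p then Some p else None.
Proof.
apply: omap_valI; rewrite pconcatE /= /pend /walk_end /=.
by case: eqP => //= ->; rewrite /pstart /parrows -surjective_pairing.
Qed.

Lemma pconcat_vertexr v p :
  pconcat p (path_vertex v) = if pend p == v then Some p else None.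
Proof.
apply: omap_valI; rewrite pconcatE /=.
by case: eqP => //= _; rewrite cats0 /pstart /parrows -surjective_pairing.
Qed.

Lemma pa_mul_suml (I : Type) (r : seq I) (F : I -> A) y :
  pa_mul (\sum_(i <- r) F i) y = \sum_(i <- r) pa_mul (F i) y.
Proof.
elim: r => [|i r IHr]; first by rewrite !big_nil pa_mul0l.
by rewrite !big_cons pa_mulDl IHr.
Qed.

Lemma pa_mul_sumr (I : Type) (r : seq I) (F : I -> A) x :
  pa_mul x (\sum_(i <- r) F i) = \sum_(i <- r) pa_mul x (F i).
Proof.
elim: r => [|i r IHr]; first by rewrite !big_nil pa_mul0r.
by rewrite !big_cons pa_mulDr IHr.
Qed.

Lemma pa_mul1l : @left_id A A pa_one pa_mul.
Proof.
apply: (pa_lin_eq (pa_mul_linr pa_one)) => [|p]; first by move=> c x y.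
rewrite pa_mul_suml (bigD1 (pstart p)) //= pa_mul_path pconcat_vertexl eqxx.
rewrite big1 ?addr0 // => v /negbTE vp.
by rewrite pa_mul_path pconcat_vertexl vp.
Qed.

Lemma pa_mul1r : @right_id A A pa_one pa_mul.
Proof.
apply: (pa_lin_eq (pa_mul_linl pa_one)) => [|p]; first by move=> c x y.
rewrite pa_mul_sumr (bigD1 (pend p)) //= pa_mul_path pconcat_vertexr eqxx.
rewrite big1 ?addr0 // => v; rewrite eq_sym => /negbTE vp.
by rewrite pa_mul_path pconcat_vertexr vp.
Qed.

HB.instance Definition _ := GRing.Zmodule_isPzRing.Build A
  pa_mulA pa_mul1l pa_mul1r pa_mulDl pa_mulDr.

Lemma pa_scalerAl c x y : c *: (x * y) = (c *: x) * y.
Proof. exact: pa_mulZl. Qed.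

Lemma pa_scalerAr c x y : c *: (x * y) = x * (c *: y).
Proof. exact: pa_mulZr. Qed.

Lemma pa_morphM (s : K -> K) (f : A -> A) :
    f 0 = 0 -> (forall c x y, f (c *: x + y) = s c *: f x + f y) ->
    (forall p q, f (pa_path p * pa_path q) = f (pa_path p) * f (pa_path q)) ->
  {morph f : x y / x * y}.
Proof.
move=> f0 fL fM.
elim/pa_ind => [|c p x IHx] y; first by rewrite f0 !mul0r.
rewrite mulrDl -pa_scalerAl !fL IHx mulrDl -pa_scalerAl.
congr (_ *: _ + _).
elim/pa_ind: y => [|d q y IHy]; first by rewrite f0 !mulr0.
by rewrite mulrDr -pa_scalerAr !fL IHy mulrDr -pa_scalerAr fM.
Qed.

End PathAlgebra.

Section IdealQuotient.
Variables (Q : quiver) (K : comNzRingType).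
Local Notation A := (pathalg Q K).
Variable S : A -> Prop.

(* The two-sided ideal generated by S: finite sums of elements a * s * b. *)
Inductive ideal_gen : A -> Prop :=
| ideal_gen0 : ideal_gen 0
| ideal_genD a s b x : S s -> ideal_gen x -> ideal_gen (a * s * b + x).

Definition ideal_pred : {pred A} := fun x => `[< ideal_gen x >].

Lemma ideal_predP x : reflect (ideal_gen x) (x \in ideal_pred).
Proof. exact: asboolP. Qed.

Lemma ideal_gen_add x y : ideal_gen x -> ideal_gen y -> ideal_gen (x + y).
Proof.
by move=> Ix Iy; elim: Ix => [|a s b z Ss _ IH]; rewrite ?add0r // -addrA;
  apply: ideal_genD.
Qed.

Lemma ideal_gen_mul a x b : ideal_gen x -> ideal_gen (a * x * b).
Proof.
elim=> [|c s d z Ss _ IH]; first by rewrite mulr0 mul0r; apply: ideal_gen0.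
rewrite mulrDr mulrDl !mulrA -(mulrA _ d b); exact: ideal_genD.
Qed.

Lemma ideal_gen_mem s : S s -> ideal_gen s.
Proof.
move=> Ss; rewrite -[s]addr0 -[s]mul1r -[1 * s]mulr1.
by apply: ideal_genD => //; apply: ideal_gen0.
Qed.

Lemma ideal_gen_opp x : ideal_gen x -> ideal_gen (- x).
Proof. by move=> /(ideal_gen_mul (-1) 1); rewrite mulr1 mulN1r. Qed.

Lemma ideal_zmod_closed : zmod_closed ideal_pred.
Proof.
split; first by apply/ideal_predP/ideal_gen0.
move=> x y /ideal_predP Ix /ideal_predP Iy; apply/ideal_predP.
exact/ideal_gen_add/ideal_gen_opp.
Qed.

HB.instance Definition _ := GRing.isZmodClosed.Build A ideal_pred
  ideal_zmod_closed.

(* The quotient algebra.  Since algType presupposes 1 != 0, which is not known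
   for an arbitrary S, the ring and module structures are given separately and
   their compatibility is algquot_scalerAl and algquot_scalerAr below. *)
Definition algquot := @Quotient.quot A ideal_pred.

HB.instance Definition _ := GRing.Zmodule.on algquot.

Definition to_quot (x : A) : algquot := \pi_(algquot)%qT x.
Definition of_quot (x : algquot) : A := repr x.

Lemma to_quotP x y : to_quot x = to_quot y <-> ideal_gen (x - y).
Proof.
rewrite /to_quot; split=> [/eqP|Ixy].
  by rewrite -Quotient.idealrBE => /ideal_predP.
by apply/eqP; rewrite -Quotient.idealrBE; apply/ideal_predP.
Qed.

Lemma of_quotK : cancel of_quot to_quot.
Proof. exact: reprK. Qed.

Lemma to_quotK x : ideal_gen (of_quot (to_quot x) - x).
Proof. by apply/to_quotP; rewrite of_quotK. Qed.

Lemma to_quot_is_zmod_morphism : zmod_morphism to_quot.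
Proof. by move=> x y; rewrite /to_quot !piE. Qed.

HB.instance Definition _ := GRing.isZmodMorphism.Build A algquot to_quot
  to_quot_is_zmod_morphism.

Lemma quotW (P : algquot -> Prop) : (forall x, P (to_quot x)) -> forall x, P x.
Proof. by move=> PP x; rewrite -(of_quotK x). Qed.

End IdealQuotient.

HB.lock Definition quot_mul Q K (S : pathalg Q K -> Prop) (x y : algquot S) :
  algquot S := to_quot S (of_quot x * of_quot y).
Arguments quot_mul {Q K S} x y.

HB.lock Definition quot_scale Q (K : comNzRingType) (S : pathalg Q K -> Prop)
    (a : K) (x : algquot S) : algquot S := to_quot S (a *: of_quot x).
Arguments quot_scale {Q K S} a x.

Section QuotientAlgebra.
Variables (Q : quiver) (K : comNzRingType).
Local Notation A := (pathalg Q K).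
Variable S : A -> Prop.
Local Notation algquot := (algquot S).
Local Notation to_quot := (to_quot S).
Local Notation ideal_gen := (ideal_gen S).
Local Notation quot_mul := (@quot_mul Q K S).
Local Notation quot_scale := (@quot_scale Q K S).

Lemma to_quot_mul x y : quot_mul (to_quot x) (to_quot y) = to_quot (x * y).
Proof.
rewrite quot_mul.unlock; apply/to_quotP.
set x' := of_quot _; set y' := of_quot _.
rewrite (_ : _ - _ = 1 * (x' - x) * y' + x * (y' - y) * 1).
  by apply: ideal_gen_add; apply: ideal_gen_mul; apply: to_quotK.
by rewrite mul1r mulr1 mulrBl mulrBr addrA subrK.
Qed.

Lemma to_quot_scale a x : quot_scale a (to_quot x) = to_quot (a *: x).
Proof.
rewrite quot_scale.unlock; apply/to_quotP.
rewrite -scalerBr -[_ - _]mul1r pa_scalerAl.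
by rewrite -[_ * _]mulr1; apply/ideal_gen_mul/to_quotK.
Qed.

Fact quot_mulA : associative quot_mul.
Proof.
by elim/quotW=> x; elim/quotW=> y; elim/quotW=> z; rewrite !to_quot_mul mulrA.
Qed.
Fact quot_mul1l : left_id (to_quot 1) quot_mul.
Proof. by elim/quotW=> x; rewrite to_quot_mul mul1r. Qed.
Fact quot_mul1r : right_id (to_quot 1) quot_mul.
Proof. by elim/quotW=> x; rewrite to_quot_mul mulr1. Qed.
Fact quot_mulDl : left_distributive quot_mul +%R.
Proof.
elim/quotW=> x; elim/quotW=> y; elim/quotW=> z.
by rewrite -raddfD !to_quot_mul mulrDl raddfD.
Qed.
Fact quot_mulDr : right_distributive quot_mul +%R.
Proof.
elim/quotW=> x; elim/quotW=> y; elim/quotW=> z.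
by rewrite -raddfD !to_quot_mul mulrDr raddfD.
Qed.
HB.instance Definition _ := GRing.Zmodule_isPzRing.Build algquot
  quot_mulA quot_mul1l quot_mul1r quot_mulDl quot_mulDr.

Fact quot_scaleA a b x : quot_scale a (quot_scale b x) = quot_scale (a * b) x.
Proof. by elim/quotW: x => x; rewrite !to_quot_scale scalerA. Qed.
Fact quot_scale1 : left_id 1 quot_scale.
Proof. by elim/quotW=> x; rewrite to_quot_scale scale1r. Qed.
Fact quot_scaleDr : right_distributive quot_scale +%R.
Proof.
move=> a; elim/quotW=> x; elim/quotW=> y.
by rewrite -raddfD !to_quot_scale scalerDr raddfD.
Qed.
Fact quot_scaleDl x : {morph quot_scale^~ x : a b / a + b}.
Proof. by elim/quotW: x => x a b; rewrite !to_quot_scale scalerDl raddfD. Qed.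
HB.instance Definition _ := GRing.Zmodule_isLmodule.Build K algquot
  quot_scaleA quot_scale1 quot_scaleDr quot_scaleDl.

Lemma algquot_scalerAl (a : K) (x y : algquot) : a *: (x * y) = (a *: x) * y.
Proof.
elim/quotW: x => x; elim/quotW: y => y.
by rewrite [LHS](congr1 (quot_scale a) (to_quot_mul x y)) to_quot_scale
  [X in _ = X * _]to_quot_scale [RHS]to_quot_mul pa_scalerAl.
Qed.
Lemma algquot_scalerAr (a : K) (x y : algquot) : a *: (x * y) = x * (a *: y).
Proof.
elim/quotW: x => x; elim/quotW: y => y.
by rewrite [LHS](congr1 (quot_scale a) (to_quot_mul x y)) to_quot_scale
  [X in _ = _ * X]to_quot_scale [RHS]to_quot_mul pa_scalerAr.
Qed.

Lemma to_quot_is_monoid_morphism : monoid_morphism to_quot.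
Proof. by split=> // x y; rewrite -to_quot_mul. Qed.
HB.instance Definition _ := GRing.isMonoidMorphism.Build A algquot to_quot
  to_quot_is_monoid_morphism.

Lemma to_quot_is_scalable : scalable to_quot.
Proof. by move=> a x; rewrite -to_quot_scale. Qed.
HB.instance Definition _ := GRing.isScalable.Build K A algquot *:%R to_quot
  to_quot_is_scalable.

(* The map induced on the quotient by an endomorphism preserving the ideal. *)
Definition quot_lift (f : A -> A) (x : algquot) : algquot :=
  to_quot (f (of_quot x)).

Section Lift.
Variable f : {rmorphism A -> A}.
Hypothesis fS : forall s, S s -> ideal_gen (f s).

Lemma quot_liftE x : quot_lift f (to_quot x) = to_quot (f x).
Proof.
apply/to_quotP; rewrite -rmorphB.
elim: (to_quotK S x) => [|a s b y Ss _ IH]; first by rewrite rmorph0; left.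
by rewrite rmorphD !rmorphM; apply/ideal_gen_add/IH/ideal_gen_mul/fS.
Qed.

Lemma quot_lift_zmod_morphism : zmod_morphism (quot_lift f).
Proof.
by elim/quotW=> x; elim/quotW=> y; rewrite -rmorphB !quot_liftE !rmorphB.
Qed.

Lemma quot_lift_monoid_morphism : monoid_morphism (quot_lift f).
Proof.
split; first by rewrite -[1 in LHS](rmorph1 to_quot) quot_liftE !rmorph1.
by elim/quotW=> x; elim/quotW=> y; rewrite -rmorphM !quot_liftE !rmorphM.
Qed.
End Lift.

End QuotientAlgebra.

Section PathAlgebraMaps.
Variables (Q : quiver) (K : comNzRingType).
Local Notation A := (pathalg Q K).

(* Action of an automorphism of K on coefficients, all paths being fixed. *)
Definition pa_mapcoef (f : K -> K) (x : A) : A :=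
  \sum_(p <- msupp x) f (pa_coeff p x) *: pa_path K p.

Section Coef.
Variable f : {rmorphism K -> K}.

Lemma pa_mapcoefE x p : pa_coeff p (pa_mapcoef f x) = f (pa_coeff p x).
Proof.
rewrite {2}[x]pa_expand !raddf_sum /=; apply: eq_bigr => q _.
by rewrite !pa_coeffZ !pa_coeff_path rmorphM rmorph_nat.
Qed.

Lemma pa_mapcoef_zmod_morphism : zmod_morphism (pa_mapcoef f).
Proof.
move=> x y; apply: pa_eqP => p.
by rewrite [RHS]raddfB /= !pa_mapcoefE -rmorphB -raddfB.
Qed.
HB.instance Definition _ := GRing.isZmodMorphism.Build A A (pa_mapcoef f)
  pa_mapcoef_zmod_morphism.

Lemma pa_mapcoefZ c x : pa_mapcoef f (c *: x) = f c *: pa_mapcoef f x.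
Proof.
apply: pa_eqP => p.
by rewrite [LHS]pa_mapcoefE [RHS]pa_coeffZ pa_mapcoefE pa_coeffZ rmorphM.
Qed.

Lemma pa_mapcoef_path p : pa_mapcoef f (pa_path K p) = pa_path K p.
Proof. by apply: pa_eqP => q; rewrite pa_mapcoefE pa_coeff_path rmorph_nat. Qed.

Lemma pa_mapcoef_monoid_morphism : monoid_morphism (pa_mapcoef f).
Proof.
split.
  by rewrite raddf_sum; apply: eq_bigr => v _; apply: pa_mapcoef_path.
apply: (@pa_morphM _ _ f) => [|c x y|p q]; first exact: raddf0.
  by rewrite raddfD /= pa_mapcoefZ.
rewrite !pa_mapcoef_path [_ * _]pa_mul_path.
by case: (pconcat p q) => [r|] /=; rewrite ?raddf0 ?pa_mapcoef_path.
Qed.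
HB.instance Definition _ := GRing.isMonoidMorphism.Build A A (pa_mapcoef f)
  pa_mapcoef_monoid_morphism.
End Coef.

End PathAlgebraMaps.

Record quiver_aut (Q : quiver) := QuiverAut {
  autv : vertex Q -> vertex Q;
  auta : arrow Q -> arrow Q;
  autv_inj : injective autv;
  auta_inj : injective auta;
  aut_src : forall a, src (auta a) = autv (src a);
  aut_tgt : forall a, tgt (auta a) = autv (tgt a)
}.

Section Relabel.
Variables (Q : quiver) (phi : quiver_aut Q) (K : comNzRingType).
Local Notation A := (pathalg Q K).

Lemma walk_aut v s :
  walk (autv phi v) [seq auta phi a | a <- s] = walk v s.
Proof.
elim: s v => [|a s IHs] v //=.
by rewrite aut_src aut_tgt IHs (inj_eq (@autv_inj _ phi)).
Qed.

Fact aut_path_subproof (p : qpath Q) :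
  walk (autv phi (pstart p)) [seq auta phi a | a <- parrows p].
Proof. by rewrite walk_aut; exact: valP p. Qed.
Definition aut_path p : qpath Q :=
  exist _ (autv phi (pstart p), [seq auta phi a | a <- parrows p])
    (aut_path_subproof p).

Lemma pend_aut p : pend (aut_path p) = autv phi (pend p).
Proof.
rewrite /pend /parrows /pstart /= -/(parrows p) -/(pstart p) /walk_end.
by elim: (parrows p) (pstart p) => //= a s IHs _; rewrite aut_tgt IHs.
Qed.

Lemma pconcat_aut p q :
  pconcat (aut_path p) (aut_path q) = omap aut_path (pconcat p q).
Proof.
apply: omap_valI; rewrite pconcatE pend_aut.
rewrite {1}/pstart /= (inj_eq (@autv_inj _ phi)).
have := pconcatE p q; case: (pconcat p q) => [r|] /=; case: eqP => // _ [rE].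
by rewrite /aut_path /pstart /parrows /= rE /= map_cat.
Qed.

Lemma aut_path_vertex v : aut_path (path_vertex v) = path_vertex (autv phi v).
Proof. exact: val_inj. Qed.

Lemma aut_path_arrow a : aut_path (path_arrow a) = path_arrow (auta phi a).
Proof. by apply: val_inj; rewrite /= -aut_src. Qed.

(* The K-linear extension of the action of phi on paths. *)
Definition pa_relabel : A -> A := pa_ext (fun p => pa_path K (aut_path p)).

HB.instance Definition _ := GRing.Linear.on pa_relabel.

Lemma pa_relabel_path p : pa_relabel (pa_path K p) = pa_path K (aut_path p).
Proof. exact: pa_ext_path. Qed.

Lemma pa_relabel_monoid_morphism : monoid_morphism pa_relabel.
Proof.
split.
  have inj : {on [pred: vertex Q | true], bijective (autv phi)}.
    by apply: onW_bij; apply: injF_bij; apply: autv_inj.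
  rewrite linear_sum [RHS](reindex _ inj); apply: eq_bigr => v _ /=.
  by rewrite pa_relabel_path aut_path_vertex.
apply: (@pa_morphM _ _ id) => [|c x y|p q]; first exact: linear0.
  exact: linearP.
rewrite !pa_relabel_path ![_ * _]pa_mul_path pconcat_aut.
by case: (pconcat p q) => [r|] /=; rewrite ?raddf0 ?pa_relabel_path.
Qed.
HB.instance Definition _ := GRing.isMonoidMorphism.Build A A pa_relabel
  pa_relabel_monoid_morphism.

End Relabel.

Arguments pa_relabel {Q} phi {K} x.

(* Vertices 1, ..., m are represented by 'I_m, the vertex j by the ordinal of
   value j - 1. *)
Definition neighbours m (e : 'I_m * 'I_m) : bool :=
  (e.1.+1 == e.2 :> nat) || (e.2.+1 == e.1 :> nat).

Definition line_arrow m := {e : 'I_m * 'I_m | neighbours e}.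
HB.instance Definition _ m := Finite.on (line_arrow m).

Section ZigzagA.
Variables (m : nat) (K : comNzRingType).

Definition zigA_quiver : quiver :=
  @Quiver 'I_m (line_arrow m) (fun a => (val a).1) (fun a => (val a).2).

Local Notation P := (pathalg zigA_quiver K).

(* The arrow (j|k), with the convention that it is 0 for non-adjacent j, k. *)
Definition arA (j k : 'I_m) : P :=
  if insub (j, k) is Some a then pa_arrow K (a : arrow zigA_quiver) else 0.

(* Here i, j, k stand for j-1, j, j+1; their existence in 'I_m says that j is
   an interior vertex. *)
Inductive zigA_rel : P -> Prop :=
| zigA_loop (i j k : 'I_m) of j = i.+1 :> nat & k = j.+1 :> nat :
    zigA_rel (arA j k * arA k j - arA j i * arA i j)
| zigA_right (i j k : 'I_m) of j = i.+1 :> nat & k = j.+1 :> nat :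
    zigA_rel (arA i j * arA j k)
| zigA_left (i j k : 'I_m) of j = i.+1 :> nat & k = j.+1 :> nat :
    zigA_rel (arA k j * arA j i).

Definition zigA := algquot zigA_rel.
HB.instance Definition _ := GRing.PzRing.on zigA.
HB.instance Definition _ := GRing.Lmodule.on zigA.

Definition zigA_vertex (j : 'I_m) : zigA :=
  to_quot zigA_rel (pa_vertex K (j : vertex zigA_quiver)).
Definition zigA_arrow (j k : 'I_m) : zigA := to_quot zigA_rel (arA j k).

Lemma neighbours_rev (e : 'I_m * 'I_m) :
  neighbours (rev_ord e.1, rev_ord e.2) = neighbours e.
Proof.
case: e => -[j hj] [k hk]; rewrite /neighbours /=.
by apply/idP/idP => /orP[/eqP E|/eqP E]; apply/orP; [right|left|right|left];
  apply/eqP; lia.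
Qed.

Fact line_rev_subproof (a : line_arrow m) :
  neighbours (rev_ord (val a).1, rev_ord (val a).2).
Proof. by rewrite neighbours_rev; exact: valP a. Qed.
Definition line_rev (a : line_arrow m) : line_arrow m :=
  exist _ (rev_ord (val a).1, rev_ord (val a).2) (line_rev_subproof a).

Lemma line_rev_inj : injective line_rev.
Proof.
move=> a b /(congr1 val) ab; apply: val_inj.
rewrite [LHS]surjective_pairing [RHS]surjective_pairing.
congr pair; apply: rev_ord_inj; [exact: (congr1 fst ab)|exact: (congr1 snd ab)].
Qed.

(* The reflection of the diagram: rev_ord is j |-> m + 1 - j on 1, ..., m. *)
Definition zigA_reflection : quiver_aut zigA_quiver :=
  @QuiverAut zigA_quiver (@rev_ord m) line_rev (@rev_ord_inj m) line_rev_inj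
    (fun=> erefl) (fun=> erefl).

Lemma arA_relabel j k :
  pa_relabel zigA_reflection (arA j k) = arA (rev_ord j) (rev_ord k).
Proof.
rewrite /arA; case: insubP => [a nA aE|nA]; last first.
  by rewrite linear0 insubN // (neighbours_rev (j, k)).
have nR : neighbours (rev_ord j, rev_ord k) by rewrite (neighbours_rev (j, k)).
rewrite (insubT _ nR) /pa_arrow pa_relabel_path aut_path_arrow.
by congr (pa_path _ (path_arrow _)); apply: val_inj; rewrite /= aE.
Qed.

Lemma zigA_rel_relabel s :
  zigA_rel s -> ideal_gen zigA_rel (pa_relabel zigA_reflection s).
Proof.
have revS (i j : 'I_m) : j = i.+1 :> nat -> rev_ord i = (rev_ord j).+1 :> nat.
  by case: i j => i hi [j hj] /=; lia.
case=> i j k /revS ij /revS jk; rewrite ?rmorphB !rmorphM /= !arA_relabel.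
- by rewrite -opprB; apply/ideal_gen_opp/ideal_gen_mem/zigA_loop.
- exact/ideal_gen_mem/zigA_left.
- exact/ideal_gen_mem/zigA_right.
Qed.

Definition zigA_tau : zigA -> zigA :=
  quot_lift (pa_relabel zigA_reflection).
HB.instance Definition _ := GRing.isZmodMorphism.Build zigA zigA zigA_tau
  (quot_lift_zmod_morphism zigA_rel_relabel).
HB.instance Definition _ := GRing.isMonoidMorphism.Build zigA zigA zigA_tau
  (quot_lift_monoid_morphism zigA_rel_relabel).

Lemma zigA_tauE x : zigA_tau (to_quot _ x) =
  to_quot _ (pa_relabel zigA_reflection x).
Proof. exact: (quot_liftE zigA_rel_relabel). Qed.

Lemma zigA_tau_scalable : scalable zigA_tau.
Proof.
by move=> a; elim/quotW=> x; rewrite -linearZ !zigA_tauE !linearZ.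
Qed.
HB.instance Definition _ := GRing.isScalable.Build K zigA zigA *:%R zigA_tau
  zigA_tau_scalable.

Lemma zigA_tau_vertex j : zigA_tau (zigA_vertex j) = zigA_vertex (rev_ord j).
Proof.
by rewrite zigA_tauE /pa_vertex pa_relabel_path aut_path_vertex.
Qed.

Lemma zigA_tau_arrow j k :
  zigA_tau (zigA_arrow j k) = zigA_arrow (rev_ord j) (rev_ord k).
Proof. by rewrite zigA_tauE arA_relabel. Qed.

Section Coef.
Variable f : {rmorphism K -> K}.

Lemma arA_coef j k : pa_mapcoef f (arA j k) = arA j k.
Proof.
by rewrite /arA; case: insubP => [a _ _|_]; rewrite ?raddf0 ?pa_mapcoef_path.
Qed.

Lemma zigA_rel_coef s : zigA_rel s -> ideal_gen zigA_rel (pa_mapcoef f s).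
Proof.
case=> i j k ij jk; rewrite ?rmorphB !rmorphM /= !arA_coef;
  apply: ideal_gen_mem.
- exact: zigA_loop.
- exact: zigA_right.
- exact: zigA_left.
Qed.

Definition zigA_coef : zigA -> zigA := quot_lift (pa_mapcoef f).
HB.instance Definition _ := GRing.isZmodMorphism.Build zigA zigA zigA_coef
  (quot_lift_zmod_morphism zigA_rel_coef).
HB.instance Definition _ := GRing.isMonoidMorphism.Build zigA zigA zigA_coef
  (quot_lift_monoid_morphism zigA_rel_coef).

Lemma zigA_coefE x : zigA_coef (to_quot _ x) = to_quot _ (pa_mapcoef f x).
Proof. exact: (quot_liftE zigA_rel_coef). Qed.

Lemma zigA_coefZ a x : zigA_coef (a *: x) = f a *: zigA_coef x.
Proof.
by elim/quotW: x => x; rewrite -linearZ !zigA_coefE pa_mapcoefZ linearZ.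
Qed.

Lemma zigA_coef_path p :
  zigA_coef (to_quot _ (pa_path K p)) = to_quot _ (pa_path K p).
Proof. by rewrite zigA_coefE pa_mapcoef_path. Qed.
End Coef.

End ZigzagA.

Section ZigzagB.
Variables (n : nat) (K : comNzRingType).

(* Loops at the vertices 2, ..., n. *)
Definition loop_arrow := {j : 'I_n | 0 < j}%N.

Definition zigB_arrow_end (b : bool) (a : line_arrow n + loop_arrow) : 'I_n :=
  match a with
  | inl e => if b then (val e).2 else (val e).1
  | inr j => val j
  end.

Definition zigB_quiver : quiver :=
  @Quiver 'I_n (line_arrow n + loop_arrow)%type
    (zigB_arrow_end false) (zigB_arrow_end true).

Local Notation P := (pathalg zigB_quiver K).

(* The arrow (j|k), and 0 for non-adjacent j, k. *)
Definition arB (j k : 'I_n) : P :=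
  if insub (j, k) is Some a then pa_arrow K (inl a : arrow zigB_quiver) else 0.

(* The loop ie_j, and 0 for j the first vertex. *)
Definition ieB (j : 'I_n) : P :=
  if insub j is Some a then pa_arrow K (inr a : arrow zigB_quiver) else 0.

Definition eB (j : 'I_n) : P := pa_vertex K (j : vertex zigB_quiver).

Inductive zigB_rel : P -> Prop :=
| zigB_loop (i j k : 'I_n) of j = i.+1 :> nat & k = j.+1 :> nat :
    zigB_rel (arB j i * arB i j - arB j k * arB k j)
| zigB_right (i j k : 'I_n) of j = i.+1 :> nat & k = j.+1 :> nat :
    zigB_rel (arB i j * arB j k)
| zigB_left (i j k : 'I_n) of j = i.+1 :> nat & k = j.+1 :> nat :
    zigB_rel (arB k j * arB j i)
| zigB_ie_sqr (j : 'I_n) of (0 < j)%N :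
    zigB_rel (ieB j ^+ 2 + eB j)
| zigB_ie_right (i j : 'I_n) of (0 < i)%N & j = i.+1 :> nat :
    zigB_rel (ieB i * arB i j - arB i j * ieB j)
| zigB_ie_left (i j : 'I_n) of (0 < i)%N & j = i.+1 :> nat :
    zigB_rel (ieB j * arB j i - arB j i * ieB i)
| zigB_ie_first (v1 v2 : 'I_n) of v1 = 0 :> nat & v2 = 1 :> nat :
    zigB_rel (arB v1 v2 * ieB v2 * arB v2 v1)
| zigB_ie_X2 (v1 v2 : 'I_n) of v1 = 0 :> nat & v2 = 1 :> nat :
    zigB_rel (ieB v2 * (arB v2 v1 * arB v1 v2)
              - (arB v2 v1 * arB v1 v2) * ieB v2).

Definition zigB := algquot zigB_rel.
HB.instance Definition _ := GRing.PzRing.on zigB.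
HB.instance Definition _ := GRing.Lmodule.on zigB.

End ZigzagB.

Section Invariants.
Variables (R : realType) (m : nat).

(* Conjugate-linear: zigA_coefZ and zigA_coef_path, with f := conjc. *)
Definition zigA_conj : zigA m R[i] -> zigA m R[i] := @zigA_coef m R[i] conjc.
HB.instance Definition _ := GRing.RMorphism.on zigA_conj.

(* The generator of the diagonal Z/2. *)
Definition zigA_diag (x : zigA m R[i]) : zigA m R[i] :=
  zigA_tau (zigA_conj x).

(* The complex algebra regarded as a real algebra by restriction of scalars. *)
Definition zigA_real : Type := zigA m R[i].
HB.instance Definition _ := GRing.PzRing.on zigA_real.

Definition real_scale (a : R) (x : zigA_real) : zigA_real :=
  (a%:C)%C *: (x : zigA m R[i]).

Fact real_scaleA a b x : real_scale a (real_scale b x) = real_scale (a * b) x.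
Proof. by rewrite /real_scale scalerA -rmorphM. Qed.
Fact real_scale1 : left_id 1 real_scale.
Proof. by move=> x; rewrite /real_scale rmorph1 scale1r. Qed.
Fact real_scaleDr : right_distributive real_scale +%R.
Proof. by move=> a x y; rewrite /real_scale scalerDr. Qed.
Fact real_scaleDl x : {morph real_scale^~ x : a b / a + b}.
Proof. by move=> a b; rewrite /real_scale rmorphD scalerDl. Qed.
HB.instance Definition _ := GRing.Zmodule_isLmodule.Build R zigA_real
  real_scaleA real_scale1 real_scaleDr real_scaleDl.

Local Notation AR := zigA_real.

Definition zigA_invariant : {pred AR} := fun x => zigA_diag x == x.

Lemma zigA_invariantP (x : AR) :
  reflect (zigA_diag x = x) (x \in zigA_invariant).
Proof. exact: eqP. Qed.

Fact zigA_invariant_subring : subring_closed zigA_invariant.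
Proof.
split.
- by apply/zigA_invariantP; rewrite /zigA_diag !rmorph1.
- move=> x y /zigA_invariantP xI /zigA_invariantP yI; apply/zigA_invariantP.
  by rewrite -[in RHS]xI -[in RHS]yI /zigA_diag !rmorphB.
- move=> x y /zigA_invariantP xI /zigA_invariantP yI; apply/zigA_invariantP.
  by rewrite -[in RHS]xI -[in RHS]yI /zigA_diag !rmorphM.
Qed.

Fact zigA_invariant_scaler : GRing.scaler_closed zigA_invariant.
Proof.
move=> a x /zigA_invariantP xI; apply/zigA_invariantP.
rewrite -[in RHS]xI /zigA_diag [zigA_conj _]zigA_coefZ.
by rewrite [X in X *: _]conjc_real linearZ.
Qed.

HB.instance Definition _ := GRing.isSubringClosed.Build AR zigA_invariant
  zigA_invariant_subring.
HB.instance Definition _ := GRing.isScaleClosed.Build R AR zigA_invariant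
  zigA_invariant_scaler.

(* The invariant subalgebra, as a real algebra in its own right. *)
Record zigA_inv : Type := ZigAInv {
  zigA_inv_val : AR;
  zigA_inv_prop : zigA_inv_val \in zigA_invariant
}.
HB.instance Definition _ := [isSub for zigA_inv_val].
HB.instance Definition _ := [Choice of zigA_inv by <:].
HB.instance Definition _ :=
  GRing.SubChoice_isSubPzRing.Build AR zigA_invariant zigA_inv
    zigA_invariant_subring.
HB.instance Definition _ := [SubZmodule_isSubLmodule of zigA_inv by <:].

Lemma zigA_inv_scalerAl (a : R) (x y : zigA_inv) :
  a *: (x * y) = (a *: x) * y.
Proof. apply: val_inj; exact: algquot_scalerAl. Qed.

Lemma zigA_inv_scalerAr (a : R) (x y : zigA_inv) :
  a *: (x * y) = x * (a *: y).
Proof. apply: val_inj; exact: algquot_scalerAr. Qed.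

End Invariants.

(* Main.v *)
From HB Require Import structures.
Require Import Defs.
From mathcomp Require Import all_boot all_order all_algebra.
From mathcomp Require Import complex reals.
From mathcomp Require Import zify.

(* Over the complex numbers, the relation (ie_j)^2 = -e_j splits e_j, for j > 1,
   into the two orthogonal idempotents (e_j -/+ i ie_j)/2, which unfolds the
   diagram B_n into A_(2n-1): they correspond to the two vertices at distance
   j - 1 from the middle vertex n.  This gives a map g from A_(2n-1) to the
   complexification of B_n, and conversely
     e_j |-> e_(n+j-1) + e_(n-j+1),  ie_j |-> i e_(n+j-1) - i e_(n-j+1),
     (j|k) |-> (n+j-1|n+k-1) + (n-j+1|n-k+1)
   (with e_1 |-> e_n) defines a real algebra map f from B_n to the invariants.
   On generators, g (f x) = x, and the complex-linear extension of f is a left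
   inverse of g.  Hence f is injective, and if x is invariant and
   g x = u + i v, then x = f u + i f v, while applying the involution gives
   x = f u - i f v, so that x = f u. *)

Set Implicit Arguments.
Unset Strict Implicit.
Unset Printing Implicit Defensive.

Import GRing.Theory.
Local Open Scope ring_scope.

(** * Presentations of algebras by quivers with relations *)

Section Generators.
Variables (Q : quiver) (K : comNzRingType).

(** A nonempty path is its first arrow followed by a shorter path. This reduces statements about
    basis paths to the generators. *)
Lemma qpath_cons_ind (P : qpath Q -> Prop) :
  (forall v, P (path_vertex v)) ->
  (forall a p q, P p -> pconcat (path_arrow a) p = Some q -> P q) ->
  forall p, P p.
Proof.
move=> Pv Pa [[v s] /= w]; elim: s v w => [|a s IHs] v w.
  by rewrite (_ : exist _ _ _ = path_vertex v) //; apply: val_inj.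
have /= /andP[/eqP av ws] := w.
apply: (Pa a) (IHs _ ws) _; apply: omap_valI; rewrite pconcatE /=.
by rewrite /pend /walk_end /pstart /= eqxx av.
Qed.

Lemma pathalg_gen_ind (P : pathalg Q K -> Prop) :
    (forall x y, P x -> P y -> P (x + y)) ->
    (forall x y, P x -> P y -> P (x * y)) ->
    (forall c x, P x -> P (c *: x)) ->
    (forall v, P (pa_vertex K v)) -> (forall a, P (pa_arrow K a)) ->
  P 0 -> forall x, P x.
Proof.
move=> PD PM PZ Pv Pa P0; elim/pa_ind=> // c p x Px; apply: (PD) => //.
apply: PZ; elim/qpath_cons_ind: p => // a p q Pp ap.
suff <- : pa_arrow K a * pa_path K p = pa_path K q by apply: PM.
by rewrite [LHS]pa_mul_path ap.
Qed.

Lemma algquot_gen_ind (S : pathalg Q K -> Prop) (P : algquot S -> Prop) :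
    (forall x y, P x -> P y -> P (x + y)) ->
    (forall x y, P x -> P y -> P (x * y)) ->
    (forall c x, P x -> P (c *: x)) ->
    (forall v, P (to_quot S (pa_vertex K v))) ->
    (forall a, P (to_quot S (pa_arrow K a))) ->
  P 0 -> forall x, P x.
Proof.
move=> PD PM PZ Pv Pa P0 z; rewrite -(of_quotK z).
elim/pathalg_gen_ind: (of_quot z) => //.
- by move=> x y Px Py; rewrite rmorphD; apply: PD.
- by move=> x y Px Py; rewrite rmorphM; apply: PM.
- by move=> c x Px; rewrite linearZ; apply: PZ.
- by rewrite rmorph0.
Qed.

End Generators.

(** The morphism is a phantom argument: it lets the type carry the [K]-module structure induced by
    it, so that [pa_ext] can extend linearly into an arbitrary ring [T]. *)
Definition restrict_scalars (K T : pzRingType) (_ : K -> T) : Type := T.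

Section RestrictScalars.
Variables (K T : pzRingType) (iota : {rmorphism K -> T}).
Local Notation V := (restrict_scalars iota).

HB.instance Definition _ := GRing.Zmodule.copy V T.

Fact restrict_scalarsA (a b : K) (x : V) :
  iota a * (iota b * x) = iota (a * b) * x.
Proof. by rewrite rmorphM mulrA. Qed.
Fact restrict_scalars1 : left_id 1 (fun a (x : V) => iota a * x : V).
Proof. by move=> x; rewrite rmorph1 mul1r. Qed.
Fact restrict_scalarsDr :
  right_distributive (fun a (x : V) => iota a * x : V) +%R.
Proof. by move=> a x y; apply: mulrDr. Qed.
Fact restrict_scalarsDl (x : V) :
  {morph (fun a => iota a * x : V) : a b / a + b}.
Proof. by move=> a b; rewrite rmorphD; apply: mulrDl. Qed.
HB.instance Definition _ := GRing.Zmodule_isLmodule.Build K V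
  restrict_scalarsA restrict_scalars1 restrict_scalarsDr restrict_scalarsDl.

End RestrictScalars.

(** * Universal properties of path algebras and their quotients *)

Section UniversalProperty.
Variables (Q : quiver) (K : comNzRingType) (T : pzRingType).
Variable iota : {rmorphism K -> T}.
Hypothesis iotaC : forall c x, iota c * x = x * iota c.
Variables (E : vertex Q -> T) (F : arrow Q -> T).
Hypothesis EE : forall v w, E v * E w = if v == w then E v else 0.
Hypothesis E1 : \sum_v E v = 1.
Hypothesis EF : forall a, E (src a) * F a = F a.
Hypothesis FE : forall a, F a * E (tgt a) = F a.

(** The product of the arrows is closed by the idempotent of the end vertex, so that constant paths
    need no separate case. *)
Fixpoint walk_val v (s : seq (arrow Q)) : T :=
  if s is a :: s' then F a * walk_val (tgt a) s' else E v.

Definition path_val (p : qpath Q) : T := walk_val (pstart p) (parrows p).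

Lemma walk_vall v s : walk v s -> E v * walk_val v s = walk_val v s.
Proof.
case: s => [|a s] /=; first by rewrite EE eqxx.
by case/andP=> /eqP <- _; rewrite mulrA EF.
Qed.

Lemma walk_valr v s : walk_val v s * E (walk_end v s) = walk_val v s.
Proof.
by elim: s v => [|a s IHs] v /=; rewrite ?EE ?eqxx // -mulrA IHs.
Qed.

Lemma walk_val_cat v s t : walk (walk_end v s) t ->
  walk_val v (s ++ t) = walk_val v s * walk_val (walk_end v s) t.
Proof.
elim: s v => [|a s IHs] v w /=; first by rewrite walk_vall.
by rewrite -mulrA IHs.
Qed.

Lemma path_valM p q :
  path_val p * path_val q = if pconcat p q is Some r then path_val r else 0.
Proof.
have := pconcatE p q; case: (pconcat p q) => [r|] /=; case: eqP => // pq.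
  case=> rE; rewrite [RHS]/path_val /pstart /parrows rE /=.
  by rewrite walk_val_cat -/(pend p) pq //; exact: valP q.
(* The end points differ: the idempotents inserted at the end of [p] and at the start of [q] are
   orthogonal. *)
move=> _; rewrite -[path_val p]walk_valr -[path_val q]walk_vall; last first.
  exact: valP q.
by rewrite mulrA -[_ * E _ * E _]mulrA EE -/(pend p); case: eqP pq;
   rewrite // mulr0 mul0r.
Qed.

Definition path_ext : pathalg Q K -> restrict_scalars iota :=
  pa_ext (path_val : qpath Q -> restrict_scalars iota).
HB.instance Definition _ := GRing.Linear.on path_ext.

Lemma path_extZ c x : path_ext (c *: x) = iota c * path_ext x :> T.
Proof. exact: linearZ. Qed.

Lemma path_extM x y :
  path_ext (x * y) = (path_ext x : T) * (path_ext y : T) :> T.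
Proof.
elim/pa_ind: x => [|c p x IHx]; first by rewrite mul0r raddf0 mul0r.
rewrite mulrDl -pa_scalerAl !raddfD /= !path_extZ IHx [in RHS]mulrDl -mulrA.
congr (_ * _ + _); elim/pa_ind: y {x IHx} => [|d q y IHy].
  by rewrite mulr0 raddf0 mulr0.
rewrite mulrDr -pa_scalerAr !raddfD /= !path_extZ IHy [in RHS]mulrDr.
(* The scalar [d] of the second factor passes the value of [p] because the image of [iota] is
   central. *)
rewrite mulrA -[in RHS]iotaC -mulrA; congr (_ * _ + _).
rewrite [X in path_ext X]pa_mul_path /path_ext !pa_ext_path path_valM.
by case: (pconcat p q) => [r|] /=; rewrite ?pa_ext_path ?raddf0.
Qed.

Lemma path_ext1 : path_ext 1 = 1 :> T.
Proof.
by rewrite -E1 raddf_sum; apply: eq_bigr => v _;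
  rewrite /= /path_ext pa_ext_path.
Qed.

Lemma pathalg_lift : exists phi : {rmorphism pathalg Q K -> T},
  [/\ forall c x, phi (c *: x) = iota c * phi x,
      forall v, phi (pa_vertex K v) = E v
    & forall a, phi (pa_arrow K a) = F a].
Proof.
pose fA := GRing.isZmodMorphism.Build (pathalg Q K) T path_ext
  (raddfB path_ext).
pose fM := GRing.isMonoidMorphism.Build (pathalg Q K) T path_ext
  (path_ext1, path_extM).
pose phi : {rmorphism pathalg Q K -> T} := HB.pack (path_ext : _ -> T) fA fM.
exists phi; split=> [|v|a]; first exact: path_extZ.
  by rewrite /= /path_ext pa_ext_path.
by rewrite /= /path_ext pa_ext_path /path_val /= FE.
Qed.

End UniversalProperty.

(** Vanishing on the relations gives vanishing on the ideal they generate, so evaluating [phi] on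
    the chosen representative [of_quot] is independent of the choice. *)
Lemma algquot_factor (Q : quiver) (K : comNzRingType) (T : pzRingType)
    (S : pathalg Q K -> Prop) (phi : {rmorphism pathalg Q K -> T}) :
    (forall s, S s -> phi s = 0) ->
  exists psi : {rmorphism algquot S -> T}, forall x, psi (to_quot S x) = phi x.
Proof.
move=> phiS; pose psi (x : algquot S) := phi (of_quot x).
have psiE x : psi (to_quot S x) = phi x.
  apply/eqP; rewrite -subr_eq0 -rmorphB; apply/eqP.
  elim: (to_quotK S x) => [|a s b y /phiS s0 _ IH]; first exact: rmorph0.
  by rewrite rmorphD !rmorphM s0 IH mulr0 mul0r addr0.
have psiB : zmod_morphism psi.
  by move=> x y; rewrite -[x]of_quotK -[y]of_quotK -rmorphB !psiE rmorphB.
have psiM : monoid_morphism psi.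
  split; first by rewrite -(rmorph1 (to_quot S)) psiE rmorph1.
  by move=> x y; rewrite -[x]of_quotK -[y]of_quotK -rmorphM !psiE rmorphM.
pose fA := GRing.isZmodMorphism.Build (algquot S) T psi psiB.
pose fM := GRing.isMonoidMorphism.Build (algquot S) T psi psiM.
pose Psi : {rmorphism algquot S -> T} := HB.pack psi fA fM.
by exists Psi.
Qed.

(** * Complexification *)

(* The pair (x, y) stands for x + i y. *)
Definition complexification (B : pzRingType) : Type := (B * B)%type.

Section Complexification.
Variable B : pzRingType.
Local Notation T := (complexification B).

HB.instance Definition _ := GRing.Zmodule.copy T (B * B)%type.

Definition cplx_mul (x y : T) : T :=
  (x.1 * y.1 - x.2 * y.2, x.1 * y.2 + x.2 * y.1).

Fact cplx_mulA : associative cplx_mul.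
Proof.
case=> a b [c d] [e f]; rewrite /cplx_mul /=.
congr pair; rewrite !(mulrDl, mulrDr, mulrN, mulNr, mulrA, opprD, opprK)
  -!addrA;
  by congr (_ + _); rewrite [RHS]addrC -!addrA.
Qed.
Fact cplx_mul1l : left_id ((1, 0) : T) cplx_mul.
Proof.
by case=> a b; rewrite /cplx_mul /= !mul0r !mul1r subr0 addr0.
Qed.
Fact cplx_mul1r : right_id ((1, 0) : T) cplx_mul.
Proof.
by case=> a b; rewrite /cplx_mul /= !mulr0 !mulr1 subr0 add0r.
Qed.
Fact cplx_mulDl : left_distributive cplx_mul +%R.
Proof.
case=> a b [c d] [e f]; rewrite /cplx_mul /=.
by congr pair; rewrite !mulrDl ?opprD addrACA.
Qed.
Fact cplx_mulDr : right_distributive cplx_mul +%R.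
Proof.
case=> a b [c d] [e f]; rewrite /cplx_mul /=.
by congr pair; rewrite !mulrDr ?opprD addrACA.
Qed.
HB.instance Definition _ := GRing.Zmodule_isPzRing.Build T
  cplx_mulA cplx_mul1l cplx_mul1r cplx_mulDl cplx_mulDr.

Lemma cplx_mulE (x y : T) :
  x * y = (x.1 * y.1 - x.2 * y.2, x.1 * y.2 + x.2 * y.1).
Proof. by []. Qed.

Definition cplx_re (x : B) : T := (x, 0).

Fact cplx_re_zmod_morphism : zmod_morphism cplx_re.
Proof. by move=> x y; congr pair; rewrite subr0. Qed.
Fact cplx_re_monoid_morphism : monoid_morphism cplx_re.
Proof.
by split=> // x y; rewrite cplx_mulE /= !mulr0 mul0r subr0 addr0.
Qed.
HB.instance Definition _ := GRing.isZmodMorphism.Build B T cplx_re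
  cplx_re_zmod_morphism.
HB.instance Definition _ := GRing.isMonoidMorphism.Build B T cplx_re
  cplx_re_monoid_morphism.

Section Scalars.
Variables (R : rcfType) (iota : {rmorphism R -> B}).

(** The structure morphism that makes the complexification an algebra over [R[i]], in the form in
    which the lifting lemmas take scalars. *)
Definition cplx_scalar (c : R[i]) : T := (iota (Re c), iota (Im c)).

Fact cplx_scalar_zmod_morphism : zmod_morphism cplx_scalar.
Proof. by move=> [a b] [c d]; congr pair; rewrite /= rmorphB. Qed.
Fact cplx_scalar_monoid_morphism : monoid_morphism cplx_scalar.
Proof.
split=> [|[a b] [c d]]; first by congr pair; rewrite /= ?rmorph1 ?rmorph0.
by rewrite cplx_mulE; congr pair; rewrite /= ?rmorphB ?rmorphD !rmorphM.
Qed.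
HB.instance Definition _ := GRing.isZmodMorphism.Build R[i] T cplx_scalar
  cplx_scalar_zmod_morphism.
HB.instance Definition _ := GRing.isMonoidMorphism.Build R[i] T cplx_scalar
  cplx_scalar_monoid_morphism.

Lemma cplx_scalarC : (forall a x, iota a * x = x * iota a) ->
  forall c x, cplx_scalar c * x = x * cplx_scalar c.
Proof.
move=> iotaC [a b] [c d]; rewrite !cplx_mulE /= !iotaC.
by rewrite [X in (_, X)]addrC.
Qed.
End Scalars.

Section Extension.
Variables (A : pzRingType) (f : {rmorphism B -> A}) (i : A).
Hypothesis ii : i * i = -1.
Hypothesis iC : forall x, i * x = x * i.

Definition cplx_ext (x : T) : A := f x.1 + i * f x.2.

Fact cplx_ext_zmod_morphism : zmod_morphism cplx_ext.
Proof.
by move=> x y; rewrite /cplx_ext !rmorphB mulrBr opprD addrACA.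
Qed.

Fact cplx_ext_monoid_morphism : monoid_morphism cplx_ext.
Proof.
split=> [|x y]; rewrite /cplx_ext.
  by rewrite rmorph1 rmorph0 mulr0 addr0.
have ai a b : a * (i * b) = i * (a * b) by rewrite mulrA -iC mulrA.
rewrite cplx_mulE /= rmorphB rmorphD !rmorphM mulrDl !mulrDr.
rewrite !ai -[i * f x.2 * f y.1]mulrA -[i * f x.2 * _]mulrA.
(* Centrality has brought both factors [i] of the product of the imaginary parts to the front, where
   they give the sign. *)
rewrite [X in _ = _ + (_ + X)]mulrA ii mulN1r.
by rewrite -!addrA; congr (_ + _); rewrite addrC -!addrA.
Qed.

Lemma cplx_ext_rmorphism :
  exists F : {rmorphism T -> A}, forall x, F x = f x.1 + i * f x.2.
Proof.
pose fA := GRing.isZmodMorphism.Build T A cplx_ext cplx_ext_zmod_morphism.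
pose fM := GRing.isMonoidMorphism.Build T A cplx_ext cplx_ext_monoid_morphism.
pose F : {rmorphism T -> A} := HB.pack cplx_ext fA fM.
by exists F.
Qed.
End Extension.

End Complexification.

(** * Scalars of a quotient algebra as central elements *)

Definition algquot_scalar (Q : quiver) (K : comNzRingType)
  (S : pathalg Q K -> Prop) (c : K) : algquot S := c *: (1 : algquot S).

Section AlgquotScalar.
Variables (Q : quiver) (K : comNzRingType) (S : pathalg Q K -> Prop).

Lemma algquot_scalarE c x : algquot_scalar S c * x = c *: x.
Proof. by rewrite -algquot_scalerAl mul1r. Qed.

Lemma algquot_scalarC c x : algquot_scalar S c * x = x * algquot_scalar S c.
Proof. by rewrite algquot_scalarE -algquot_scalerAr mulr1. Qed.

Fact algquot_scalar_zmod_morphism : zmod_morphism (@algquot_scalar Q K S).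
Proof. by move=> a b; apply: scalerBl. Qed.
Fact algquot_scalar_monoid_morphism : monoid_morphism (@algquot_scalar Q K S).
Proof.
by split=> [|a b]; rewrite ?algquot_scalarE /algquot_scalar ?scale1r ?scalerA.
Qed.
HB.instance Definition _ := GRing.isZmodMorphism.Build K (algquot S)
  (@algquot_scalar Q K S) algquot_scalar_zmod_morphism.
HB.instance Definition _ := GRing.isMonoidMorphism.Build K (algquot S)
  (@algquot_scalar Q K S) algquot_scalar_monoid_morphism.
End AlgquotScalar.

(** * Relations in the zigzag algebras *)

Section PathProducts.
Variables (Q : quiver) (K : comNzRingType).

Lemma pa_vertexM (v w : vertex Q) :
  pa_vertex K v * pa_vertex K w = if v == w then pa_vertex K v else 0.
Proof.
rewrite [LHS]pa_mul_path pconcat_vertexl /pstart /=.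
by case: eqP => // ->.
Qed.

Lemma pa_vertex_arrow (a : arrow Q) :
  pa_vertex K (src a) * pa_arrow K a = pa_arrow K a.
Proof. by rewrite [LHS]pa_mul_path pconcat_vertexl eqxx. Qed.

Lemma pa_arrow_vertex (a : arrow Q) :
  pa_arrow K a * pa_vertex K (tgt a) = pa_arrow K a.
Proof. by rewrite [LHS]pa_mul_path pconcat_vertexr eqxx. Qed.

End PathProducts.

Section LineRelations.
Variables (T : pzRingType) (m : nat) (a : 'I_m -> 'I_m -> T).
Hypothesis a0 : forall j k, ~~ neighbours (j, k) -> a j k = 0.
Hypothesis a_right : forall i j k : 'I_m, j = i.+1 :> nat -> k = j.+1 :> nat ->
  a i j * a j k = 0.
Hypothesis a_left : forall i j k : 'I_m, j = i.+1 :> nat -> k = j.+1 :> nat ->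
  a k j * a j i = 0.
Hypothesis a_loop : forall i j k : 'I_m, j = i.+1 :> nat -> k = j.+1 :> nat ->
  a j k * a k j = a j i * a i j.

(** Two distinct neighbours of [j] lie on opposite sides of it, so one of the two oriented relations
    applies; if one of the pairs is not adjacent, a factor is 0. The hypotheses are abstract because
    both zigzag algebras use this. *)
Lemma line_mul0 i j k : i != k -> a i j * a j k = 0.
Proof.
move=> ik; case: (boolP (neighbours (i, j))) => [|/a0->]; last by rewrite mul0r.
case: (boolP (neighbours (j, k))) => [|/a0->]; last by rewrite mulr0.
have {}ik : i <> k :> nat by move=> /val_inj E; rewrite E eqxx in ik.
rewrite /neighbours /= => /orP[]/eqP jk /orP[]/eqP ij; try lia.
  by apply: a_right; lia.
by apply: a_left; lia.
Qed.

(** Two neighbours of [j] either coincide or are the two ends in [a_loop]. *)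
Lemma line_loop i j k : neighbours (j, i) -> neighbours (j, k) ->
  a j i * a i j = a j k * a k j.
Proof.
rewrite /neighbours /= => /orP[]/eqP ij /orP[]/eqP jk.
- by rewrite (_ : i = k) //; apply: val_inj; rewrite /= -ij -jk.
- by apply: a_loop; lia.
- by apply/esym/a_loop; lia.
by rewrite (_ : i = k) //; apply: val_inj; rewrite /=; lia.
Qed.

End LineRelations.

Section ZigA.
Variables (m : nat) (K : comNzRingType).
Local Notation A := (zigA m K).
Local Notation e := (@zigA_vertex m K).
Local Notation a := (@zigA_arrow m K).

Lemma zigA_vertexM v w : e v * e w = if v == w then e v else 0.
Proof.
by rewrite -[LHS]rmorphM pa_vertexM; case: eqP => // _; rewrite rmorph0.
Qed.

Lemma zigA_vertex_sum : \sum_v e v = 1.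
Proof. by rewrite -[LHS]rmorph_sum -[RHS](rmorph1 (to_quot _)). Qed.

Lemma zigA_arrow0 j k : ~~ neighbours (j, k) -> a j k = 0.
Proof.
by move=> jk; rewrite /zigA_arrow /arA insubN // rmorph0.
Qed.

Lemma zigA_vertex_arrow j k : e j * a j k = a j k.
Proof.
rewrite -[LHS]rmorphM /zigA_arrow /arA.
case: insubP => [x _ xE|_]; last by rewrite mulr0.
by rewrite -[X in pa_vertex _ X](congr1 fst xE) pa_vertex_arrow.
Qed.

Lemma zigA_arrow_vertex j k : a j k * e k = a j k.
Proof.
rewrite -[LHS]rmorphM /zigA_arrow /arA.
case: insubP => [x _ xE|_]; last by rewrite mul0r.
by rewrite -[X in pa_vertex _ X](congr1 snd xE) pa_arrow_vertex.
Qed.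

Lemma zigA_mul0 i j k : i != k -> a i j * a j k = 0.
Proof.
apply: line_mul0 => [|{}i {}j {}k ij jk|{}i {}j {}k ij jk].
- exact: zigA_arrow0.
- rewrite -[LHS]rmorphM -(rmorph0 (to_quot _)); apply/to_quotP.
  by rewrite subr0; apply/ideal_gen_mem/zigA_right.
- rewrite -[LHS]rmorphM -(rmorph0 (to_quot _)); apply/to_quotP.
  by rewrite subr0; apply/ideal_gen_mem/zigA_left.
Qed.

Lemma zigA_loopE i j k : neighbours (j, i) -> neighbours (j, k) ->
  a j i * a i j = a j k * a k j.
Proof.
apply: line_loop => {}i {}j {}k ij jk; rewrite -[LHS]rmorphM -[RHS]rmorphM.
by apply/to_quotP/ideal_gen_mem/zigA_loop.
Qed.

Lemma zigA_gen_ind (P : A -> Prop) : P 0 ->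
    (forall x y, P x -> P y -> P (x + y)) ->
    (forall x y, P x -> P y -> P (x * y)) ->
    (forall c x, P x -> P (c *: x)) ->
    (forall j, P (e j)) -> (forall j k, P (a j k)) ->
  forall x, P x.
Proof.
move=> P0 PD PM PZ Pe Pa.
have PA : forall x, P (to_quot _ (pa_arrow K x)).
  move=> x; have := Pa (val x).1 (val x).2; rewrite /zigA_arrow /arA.
  by rewrite -surjective_pairing valK.
exact: algquot_gen_ind.
Qed.

End ZigA.

Section ZigB.
Variables (n : nat) (K : comNzRingType).
Local Notation B := (zigB n K).

Definition zigB_vertex (j : 'I_n) : B := to_quot (@zigB_rel n K) (eB K j).
Definition zigB_arrow (j k : 'I_n) : B := to_quot (@zigB_rel n K) (arB K j k).
Definition zigB_ie (j : 'I_n) : B := to_quot (@zigB_rel n K) (ieB K j).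

Local Notation e := zigB_vertex.
Local Notation b := zigB_arrow.
Local Notation J := zigB_ie.

Lemma zigB_relE x y : zigB_rel (x - y) ->
  to_quot (@zigB_rel n K) x = to_quot (@zigB_rel n K) y.
Proof. by move=> xy; apply/to_quotP/ideal_gen_mem. Qed.

Lemma zigB_rel0 x : zigB_rel x -> to_quot (@zigB_rel n K) x = 0.
Proof.
by move=> Sx; rewrite -(rmorph0 (to_quot _)); apply/zigB_relE; rewrite subr0.
Qed.

Lemma zigB_vertexM v w : e v * e w = if v == w then e v else 0.
Proof.
by rewrite -[LHS]rmorphM pa_vertexM; case: eqP => // _; rewrite rmorph0.
Qed.

Lemma zigB_vertex_sum : \sum_v e v = 1.
Proof. by rewrite -[LHS]rmorph_sum -[RHS](rmorph1 (to_quot _)). Qed.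

Lemma zigB_arrow0 j k : ~~ neighbours (j, k) -> b j k = 0.
Proof.
by move=> jk; rewrite /zigB_arrow /arB insubN // rmorph0.
Qed.

Lemma zigB_vertex_arrow j k : e j * b j k = b j k.
Proof.
rewrite -[LHS]rmorphM /zigB_arrow /arB.
case: insubP => [x _ xE|_]; last by rewrite mulr0.
rewrite -[X in eB _ X](congr1 fst xE).
exact: (congr1 (to_quot _) (@pa_vertex_arrow (zigB_quiver n) K (inl x))).
Qed.

Lemma zigB_arrow_vertex j k : b j k * e k = b j k.
Proof.
rewrite -[LHS]rmorphM /zigB_arrow /arB.
case: insubP => [x _ xE|_]; last by rewrite mul0r.
rewrite -[X in eB _ X](congr1 snd xE).
exact: (congr1 (to_quot _) (@pa_arrow_vertex (zigB_quiver n) K (inl x))).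
Qed.

Lemma zigB_vertex_ie j : e j * J j = J j.
Proof.
rewrite -[LHS]rmorphM /zigB_ie /ieB.
case: insubP => [x _ xE|_]; last by rewrite mulr0.
rewrite -[X in eB _ X]xE.
exact: (congr1 (to_quot _) (@pa_vertex_arrow (zigB_quiver n) K (inr x))).
Qed.

Lemma zigB_ie_vertex j : J j * e j = J j.
Proof.
rewrite -[LHS]rmorphM /zigB_ie /ieB.
case: insubP => [x _ xE|_]; last by rewrite mul0r.
rewrite -[X in eB _ X]xE.
exact: (congr1 (to_quot _) (@pa_arrow_vertex (zigB_quiver n) K (inr x))).
Qed.

Lemma zigB_ie0 (j : 'I_n) : j = 0%N :> nat -> J j = 0.
Proof. by move=> j0; rewrite /zigB_ie /ieB insubN ?j0 // rmorph0. Qed.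

Lemma zigB_mul0 i j k : i != k -> b i j * b j k = 0.
Proof.
apply: line_mul0 => [|{}i {}j {}k ij jk|{}i {}j {}k ij jk].
- exact: zigB_arrow0.
- by rewrite -[LHS]rmorphM; apply/zigB_rel0/zigB_right.
- by rewrite -[LHS]rmorphM; apply/zigB_rel0/zigB_left.
Qed.

Lemma zigB_loopE i j k : neighbours (j, i) -> neighbours (j, k) ->
  b j i * b i j = b j k * b k j.
Proof.
apply: line_loop => {}i {}j {}k ij jk; rewrite -[LHS]rmorphM -[RHS]rmorphM.
by apply/esym/zigB_relE/zigB_loop.
Qed.

Lemma zigB_ieM (j : 'I_n) : (0 < j)%N -> J j * J j = - e j.
Proof.
move=> j0; rewrite -[LHS]rmorphM -[RHS]rmorphN; apply: zigB_relE.
by rewrite opprK; apply: zigB_ie_sqr.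
Qed.

Lemma zigB_ie_arrow (j k : 'I_n) : (0 < j)%N -> (0 < k)%N ->
  J j * b j k = b j k * J k.
Proof.
move=> j0 k0; case: (boolP (neighbours (j, k))) => [|/zigB_arrow0->];
  last first.
  by rewrite mul0r mulr0.
rewrite -[LHS]rmorphM -[RHS]rmorphM => /orP[]/eqP /= jk; apply: zigB_relE.
  exact: zigB_ie_right.
exact: zigB_ie_left.
Qed.

Lemma zigB_ie_firstE (v w : 'I_n) : v = 0%N :> nat -> w = 1%N :> nat ->
  b v w * J w * b w v = 0.
Proof.
move=> v0 w1; rewrite -[X in X * _]rmorphM -[LHS]rmorphM.
exact/zigB_rel0/zigB_ie_first.
Qed.

Lemma zigB_ie_X2E (v w : 'I_n) : v = 0%N :> nat -> w = 1%N :> nat ->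
  J w * (b w v * b v w) = b w v * b v w * J w.
Proof.
move=> v0 w1; rewrite -[b w v * _]rmorphM -[LHS]rmorphM -[RHS]rmorphM.
exact/zigB_relE/zigB_ie_X2.
Qed.

Lemma zigB_gen_ind (P : B -> Prop) : P 0 ->
    (forall x y, P x -> P y -> P (x + y)) ->
    (forall x y, P x -> P y -> P (x * y)) ->
    (forall c x, P x -> P (c *: x)) ->
    (forall j, P (e j)) -> (forall j k, P (b j k)) -> (forall j, P (J j)) ->
  forall x, P x.
Proof.
move=> P0 PD PM PZ Pe Pb PJ.
have PA : forall a, P (to_quot _ (pa_arrow K a)).
  case=> a.
    have := Pb (val a).1 (val a).2; rewrite /zigB_arrow /arB.
    by rewrite -surjective_pairing valK.
  by have := PJ (val a); rewrite /zigB_ie /ieB valK.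
exact: algquot_gen_ind.
Qed.

End ZigB.

(** * Universal properties of the zigzag algebras *)

Section ZigALift.
Variables (m : nat) (K : comNzRingType) (T : pzRingType).
Variable iota : {rmorphism K -> T}.
Hypothesis iotaC : forall c x, iota c * x = x * iota c.
Variables (E : 'I_m -> T) (F : 'I_m -> 'I_m -> T).
Hypothesis EE : forall v w, E v * E w = if v == w then E v else 0.
Hypothesis E1 : \sum_v E v = 1.
Hypothesis F0 : forall j k, ~~ neighbours (j, k) -> F j k = 0.
Hypothesis EF : forall j k, E j * F j k = F j k.
Hypothesis FE : forall j k, F j k * E k = F j k.
Hypothesis F_mul0 : forall i j k, i != k -> F i j * F j k = 0.
Hypothesis F_loop : forall i j k, neighbours (j, i) -> neighbours (j, k) ->
  F j i * F i j = F j k * F k j.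

(** The hypotheses have the unoriented form of [line_mul0] and [line_loop], which is insensitive to
    the reversal of order that folding causes below the middle vertex. *)
Lemma zigA_lift : exists phi : {rmorphism zigA m K -> T},
  [/\ forall c x, phi (c *: x) = iota c * phi x,
      forall v, phi (zigA_vertex K v) = E v
    & forall j k, phi (zigA_arrow K j k) = F j k].
Proof.
pose Fa (a : arrow (zigA_quiver m)) := F (src a) (tgt a).
have [phi [phiZ phiE phiF]] := @pathalg_lift (zigA_quiver m) K T iota iotaC
  E Fa EE E1 (fun=> EF _ _) (fun=> FE _ _).
have phia j k : phi (arA K j k) = F j k.
  rewrite /arA; case: insubP => [x _ xE|/F0->]; last by rewrite rmorph0.
  by rewrite phiF /Fa /= xE.
have phiS s : zigA_rel s -> phi s = 0.
  case=> i j k ij jk; rewrite ?rmorphB !rmorphM !phia.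
  - by rewrite (@F_loop i j k) ?subrr // /neighbours /=; lia.
  - by apply: F_mul0; apply/eqP=> /(congr1 val) /=; lia.
  - by apply: F_mul0; apply/eqP=> /(congr1 val) /=; lia.
have [psi psiE] := algquot_factor phiS.
exists psi; split=> [c x|v|j k]; last 2 first.
- by rewrite [LHS]psiE phiE.
- by rewrite [LHS]psiE phia.
by rewrite -[x]of_quotK -linearZ [LHS]psiE phiZ [psi _]psiE.
Qed.

End ZigALift.

Section ZigBLift.
Variables (n : nat) (K : comNzRingType) (T : pzRingType).
Variable iota : {rmorphism K -> T}.
Hypothesis iotaC : forall c x, iota c * x = x * iota c.
Variables (E : 'I_n -> T) (F : 'I_n -> 'I_n -> T) (L : 'I_n -> T).
Hypothesis EE : forall v w, E v * E w = if v == w then E v else 0.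
Hypothesis E1 : \sum_v E v = 1.
Hypothesis F0 : forall j k, ~~ neighbours (j, k) -> F j k = 0.
Hypothesis EF : forall j k, E j * F j k = F j k.
Hypothesis FE : forall j k, F j k * E k = F j k.
Hypothesis F_mul0 : forall i j k, i != k -> F i j * F j k = 0.
Hypothesis F_loop : forall i j k, neighbours (j, i) -> neighbours (j, k) ->
  F j i * F i j = F j k * F k j.
Hypothesis EL : forall j, E j * L j = L j.
Hypothesis LE : forall j, L j * E j = L j.
Hypothesis L0 : forall j : 'I_n, j = 0%N :> nat -> L j = 0.
Hypothesis LL : forall j : 'I_n, (0 < j)%N -> L j * L j = - E j.
Hypothesis LF : forall j k : 'I_n, (0 < j)%N -> (0 < k)%N ->
  L j * F j k = F j k * L k.
Hypothesis L_first : forall v w : 'I_n, v = 0%N :> nat -> w = 1%N :> nat ->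
  F v w * L w * F w v = 0.
Hypothesis L_X2 : forall v w : 'I_n, v = 0%N :> nat -> w = 1%N :> nat ->
  L w * (F w v * F v w) = F w v * F v w * L w.

Lemma zigB_lift : exists phi : {rmorphism zigB n K -> T},
  [/\ forall c x, phi (c *: x) = iota c * phi x,
      forall v, phi (zigB_vertex K v) = E v,
      forall j k, phi (zigB_arrow K j k) = F j k
    & forall j, phi (zigB_ie K j) = L j].
Proof.
pose Fa (a : arrow (zigB_quiver n)) :=
  match a with inl x => F (val x).1 (val x).2 | inr x => L (val x) end.
have EFa (a : arrow (zigB_quiver n)) : E (src a) * Fa a = Fa a.
  by case: a => x /=; rewrite ?EF ?EL.
have FaE (a : arrow (zigB_quiver n)) : Fa a * E (tgt a) = Fa a.
  by case: a => x /=; rewrite ?FE ?LE.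
have [phi [phiZ phiE phiF]] := @pathalg_lift (zigB_quiver n) K T iota iotaC
  E Fa EE E1 EFa FaE.
have phia j k : phi (arB K j k) = F j k.
  rewrite /arB; case: insubP => [x _ xE|/F0->]; last by rewrite rmorph0.
  by rewrite phiF /= xE.
have phiL j : phi (ieB K j) = L j.
  rewrite /ieB; case: insubP => [x _ xE|]; first by rewrite phiF /= xE.
  by rewrite -eqn0Ngt => /eqP/L0->; rewrite rmorph0.
have phie j : phi (eB K j) = E j by apply: phiE.
have phiS s : zigB_rel s -> phi s = 0.
  case=> [i j k ij jk|i j k ij jk|i j k ij jk|j j0|i j i0 ij|i j i0 ij
         |v w v0 w1|v w v0 w1];
    rewrite ?(rmorphB, rmorphD, rmorphM) ?phia ?phiL ?phie.
  - by rewrite (@F_loop i j k) ?subrr // /neighbours /=; lia.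
  - by apply: F_mul0; apply/eqP=> /(congr1 val) /=; lia.
  - by apply: F_mul0; apply/eqP=> /(congr1 val) /=; lia.
  - by rewrite LL // addNr.
  - by rewrite LF ?subrr // ij.
  - by rewrite LF ?subrr // ij.
  - exact: L_first.
  - by rewrite L_X2 ?subrr.
have [psi psiE] := algquot_factor phiS.
exists psi; split=> [c x|v|j k|j]; last 3 first.
- by rewrite [LHS]psiE phie.
- by rewrite [LHS]psiE phia.
- by rewrite [LHS]psiE phiL.
by rewrite -[x]of_quotK -linearZ [LHS]psiE phiZ [psi _]psiE.
Qed.

End ZigBLift.

(** * Folding the diagram of type A *)

(* The index j of type B, read as the distance to the middle vertex of the
   diagram of type A, comes from the vertices at distance j above ([s] true)
   and below ([s] false) the middle one. *)
Section Folding.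
Variable n : nat.
Local Notation m := (2 * n - 1)%N.

Fact unfold_subproof (s : bool) (j : 'I_n) :
  ((if s then n.-1 + j else n.-1 - j) < m)%N.
Proof. by case: s; case: j => j hj /=; lia. Qed.
(** Ordinals count from 0: the middle vertex [n] has value [n.-1], and the first vertex of type B
    has value 0, its distance to the middle. *)
Definition unfold s j : 'I_m := Ordinal (unfold_subproof s j).

Fact fold_subproof (v : 'I_m) :
  ((if (n.-1 <= v)%N then v - n.-1 else n.-1 - v) < n)%N.
Proof. by case: v => v hv /=; case: ifP; lia. Qed.
Definition fold v : 'I_n := Ordinal (fold_subproof v).

(** By convention the middle vertex belongs to the upper side; its side carries no information,
    whence the positivity conditions below. *)
Definition side (v : 'I_m) : bool := (n.-1 <= v)%N.

Lemma foldK v : unfold (side v) (fold v) = v.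
Proof.
by apply: val_inj; rewrite /= /side; case: v => v hv /=; do 2!case: ifP => ?;
  lia.
Qed.

Lemma unfoldK s : cancel (unfold s) fold.
Proof.
by move=> j; apply: val_inj; case: s; case: j => j hj /=; case: ifP; lia.
Qed.

Lemma side_unfold s (j : 'I_n) : (0 < j)%N -> side (unfold s j) = s.
Proof. by case: s; case: j => j hj /=; rewrite /side /=; lia. Qed.

Lemma unfold_first s (j : 'I_n) : j = 0%N :> nat -> unfold s j = unfold true j.
Proof. by move=> j0; apply: val_inj; case: s => //=; rewrite j0; lia. Qed.

(** [fold] recovers the index and, away from the middle vertex, [side] recovers the side. *)
Lemma unfold_neq s t (j k : 'I_n) : (j != k) || (s != t) && (0 < j)%N ->
  unfold s j != unfold t k.
Proof.
apply: contraTneq => E; have := congr1 fold E; rewrite !unfoldK => jk.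
rewrite jk eqxx /= in E *; apply/negP=> /andP[/eqP st k0]; case: st.
by rewrite -(side_unfold s k0) E side_unfold.
Qed.

Lemma neighbours_unfold s (j k : 'I_n) :
  neighbours (unfold s j, unfold s k) = neighbours (j, k).
Proof.
by rewrite /neighbours /=; case: s; case: j k => j hj [k hk] /=;
  apply/idP/idP; lia.
Qed.

(** One can pass from one side to the other only through the middle vertex. *)
Lemma neighbours_side (v w : 'I_m) : neighbours (v, w) ->
  (0 < fold v)%N -> (0 < fold w)%N -> side v = side w.
Proof. by rewrite /neighbours /side /=; case: v w => v hv [w hw] /=;
  do 2!case: ifP => ?; lia. Qed.

Lemma neighbours_fold (v w : 'I_m) : neighbours (v, w) ->
  neighbours (fold v, fold w).
Proof.
by rewrite /neighbours /=; case: v w => v hv [w hw] /=; do 2!case: ifP => ?;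
  lia.
Qed.

Lemma unfold_rev s j : rev_ord (unfold s j) = unfold (~~ s) j.
Proof. by apply: val_inj; case: s; case: j => j hj /=; lia. Qed.

Lemma sum_fold (V : nmodType) (G : 'I_m -> V) (j : 'I_n) :
  \sum_(v | fold v == j) G v =
    if j == 0%N :> nat then G (unfold true j)
    else G (unfold true j) + G (unfold false j).
Proof.
rewrite (bigD1 (unfold true j)) ?unfoldK //=; case: eqP => [j0|/eqP j0].
  rewrite big1 ?addr0 // => v /andP[/eqP vj].
  by rewrite -{1}(foldK v) vj unfold_first ?eqxx.
rewrite (bigD1 (unfold false j)) /=; last first.
  by rewrite unfoldK eqxx unfold_neq // lt0n j0 orbT.
rewrite big1 ?addr0 // => v /andP[/andP[/eqP vj]].
by rewrite -(foldK v) vj; case: side; rewrite eqxx.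
Qed.

End Folding.

(** * From type B to type A *)

Section BtoA.
Variables (R : realType) (n : nat).
Local Notation m := (2 * n - 1)%N.
Local Notation A := (zigA m R[i]).
Local Notation e := (@zigA_vertex m R[i]).
Local Notation a := (@zigA_arrow m R[i]).
Local Notation i := ('i%C : R[i]).

Lemma zigA_scalerAl c (x y : A) : c *: (x * y) = (c *: x) * y.
Proof. exact: algquot_scalerAl. Qed.
Lemma zigA_scalerAr c (x y : A) : c *: (x * y) = x * (c *: y).
Proof. exact: algquot_scalerAr. Qed.

(* Images under f of the generators of B_n.  At the first vertex the two
   unfoldings coincide, and the sum over a set of vertices counts them once. *)
Definition lift_vertex (j : 'I_n) : A := \sum_(v | fold v == j) e v.
Definition lift_arrow s (j k : 'I_n) : A := a (unfold s j) (unfold s k).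
Definition lift_sum j k : A := lift_arrow true j k + lift_arrow false j k.
(** Up to the factor i, this is the image of [ie_j (j|k)] for [j] not the first vertex: the loop
    acts with opposite signs on the two sides. *)
Definition lift_diff j k : A := lift_arrow true j k - lift_arrow false j k.
Definition lift_ie (j : 'I_n) : A :=
  i *: (e (unfold true j) - e (unfold false j)).

Local Notation E := lift_vertex.
Local Notation al := lift_arrow.
Local Notation S := lift_sum.
Local Notation D := lift_diff.
Local Notation L := lift_ie.

Lemma lift_vertex_l j v : E j * e v = if fold v == j then e v else 0.
Proof.
rewrite mulr_suml; case: eqP => [<-|vj].
  rewrite (bigD1 v) //= zigA_vertexM eqxx big1 ?addr0 // => w
    /andP[_ /negbTE wv].
  by rewrite zigA_vertexM wv.
rewrite big1 // => w /eqP wj; rewrite zigA_vertexM; case: eqP => // wv.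
by rewrite -wj wv in vj.
Qed.

Lemma lift_vertex_r j v : e v * E j = if fold v == j then e v else 0.
Proof.
rewrite mulr_sumr; case: eqP => [<-|vj].
  rewrite (bigD1 v) //= zigA_vertexM eqxx big1 ?addr0 // => w
    /andP[_ /negbTE wv].
  by rewrite zigA_vertexM eq_sym wv.
rewrite big1 // => w /eqP wj; rewrite zigA_vertexM; case: eqP => // wv.
by rewrite -wj wv in vj.
Qed.

Lemma lift_vertexM j k : E j * E k = if j == k then E j else 0.
Proof.
rewrite [in LHS]/lift_vertex mulr_sumr; under eq_bigr do rewrite lift_vertex_l.
case: eqP => [->|jk]; first by apply: eq_bigr => v ->.
by rewrite big1 // => v /eqP vk; case: eqP => // vj; rewrite -vj -vk in jk.
Qed.

Lemma lift_vertex_sum : \sum_j E j = 1.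
Proof. by rewrite -(zigA_vertex_sum m R[i])
  [RHS](partition_big (@fold n) predT). Qed.

Lemma lift_vertex_arrow s j k : E j * al s j k = al s j k.
Proof.
by rewrite -[X in _ * X]zigA_vertex_arrow mulrA lift_vertex_l unfoldK eqxx
  zigA_vertex_arrow.
Qed.

Lemma lift_arrow_vertex s j k : al s j k * E k = al s j k.
Proof.
by rewrite -[X in X * _]zigA_arrow_vertex -mulrA lift_vertex_r unfoldK eqxx
  zigA_arrow_vertex.
Qed.

Lemma zigA_arrowM0 (u v w x : 'I_m) : v != w -> a u v * a w x = 0.
Proof.
move=> /negbTE vw; rewrite -zigA_arrow_vertex -[a w x]zigA_vertex_arrow mulrA.
by rewrite -[a u v * _ * _]mulrA zigA_vertexM vw mulr0 mul0r.
Qed.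

(** Arrows on opposite sides can only meet at the middle vertex. There the product runs straight
    through from one side to the other, and such products are 0 in type A. *)
Lemma lift_arrow_cross s t i j k : s != t -> al s i j * al t j k = 0.
Proof.
move=> st; have [E|] := eqVneq (unfold s j) (unfold t j); last first.
  exact: zigA_arrowM0.
have j0 : j = 0%N :> nat.
  by apply/eqP; rewrite -leqn0 leqNgt; apply/negP=> j0;
    have := @unfold_neq n s t j j; rewrite E st j0 !eqxx => /(_ isT).
rewrite /lift_arrow; have [ij|] := boolP (neighbours (unfold s i, unfold s j));
  last by move/zigA_arrow0->; rewrite mul0r.
rewrite -E; apply/zigA_mul0/unfold_neq; rewrite st /=.
by move: ij; rewrite neighbours_unfold /neighbours /=; lia.
Qed.

Lemma lift_sumM i j k : S i j * S j k =
  al true i j * al true j k + al false i j * al false j k.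
Proof.
by rewrite mulrDl !mulrDr (@lift_arrow_cross true false) //
  (@lift_arrow_cross false true) // addr0 add0r.
Qed.

Lemma lift_diff_sum i j k : D i j * S j k =
  al true i j * al true j k - al false i j * al false j k.
Proof.
by rewrite mulrBl !mulrDr (@lift_arrow_cross true false) //
  (@lift_arrow_cross false true) // addr0 add0r.
Qed.

Lemma lift_sum_diff i j k : S i j * D j k =
  al true i j * al true j k - al false i j * al false j k.
Proof.
by rewrite mulrDl !mulrBr (@lift_arrow_cross true false) //
  (@lift_arrow_cross false true) // subr0 sub0r.
Qed.

Lemma unfold_vertex_arrow s t (j k : 'I_n) : (0 < j)%N ->
  e (unfold s j) * al t j k = if s == t then al t j k else 0.
Proof.
move=> j0; rewrite -[X in _ * X]zigA_vertex_arrow mulrA zigA_vertexM.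
have [->|st] := eqVneq s t; first by rewrite eqxx zigA_vertex_arrow.
by rewrite (negbTE (unfold_neq _)) ?mul0r // st j0 orbT.
Qed.

Lemma unfold_arrow_vertex s t (j k : 'I_n) : (0 < k)%N ->
  al t j k * e (unfold s k) = if s == t then al t j k else 0.
Proof.
move=> k0; rewrite -[X in X * _]zigA_arrow_vertex -mulrA zigA_vertexM.
have [->|st] := eqVneq s t; first by rewrite eqxx zigA_arrow_vertex.
by rewrite (negbTE (unfold_neq _)) ?mulr0 // eq_sym st k0 orbT.
Qed.

Lemma lift_ie_arrow (j k : 'I_n) : (0 < j)%N -> L j * S j k = i *: D j k.
Proof.
move=> j0; rewrite -zigA_scalerAl; congr (_ *: _).
by rewrite mulrBl !mulrDr !unfold_vertex_arrow //= addr0 add0r.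
Qed.

Lemma lift_arrow_ie (j k : 'I_n) : (0 < k)%N -> S j k * L k = i *: D j k.
Proof.
move=> k0; rewrite -zigA_scalerAr; congr (_ *: _).
by rewrite mulrDl !mulrBr !unfold_arrow_vertex //= subr0 sub0r.
Qed.

Lemma lift_sum0 j k : ~~ neighbours (j, k) -> S j k = 0.
Proof.
by move=> jk; rewrite /lift_sum /lift_arrow !zigA_arrow0 ?addr0 //
  neighbours_unfold.
Qed.

Lemma complex_ii : i * i = -1 :> R[i].
Proof. by rewrite -expr2 sqr_i. Qed.

(** The two vertices over [j] are distinct, so the square of the difference of their idempotents is
    the sum; the sign comes from the square of i. *)
Lemma lift_ieM (j : 'I_n) : (0 < j)%N -> L j * L j = - E j.
Proof.
move=> j0; rewrite -zigA_scalerAl -zigA_scalerAr scalerA complex_ii scaleN1r.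
congr (- _); rewrite /lift_vertex sum_fold (negbTE (lt0n_neq0 j0)).
rewrite mulrBl !mulrBr !zigA_vertexM !eqxx !(negbTE (unfold_neq _)) ?j0
  ?orbT //.
by rewrite subr0 sub0r opprK.
Qed.

Lemma zigB_to_zigA : exists f : {rmorphism zigB n R -> A},
  [/\ forall c x, f (c *: x) = (c%:C)%C *: f x,
      forall j, f (zigB_vertex R j) = E j,
      forall j k, f (zigB_arrow R j k) = S j k
    & forall j, f (zigB_ie R j) = L j].
Proof.
pose iota : {rmorphism R -> A} := @algquot_scalar _ _ (@zigA_rel m R[i]) \o
  @real_complex R.
have iotaE c x : iota c * x = (c%:C)%C *: x by exact: algquot_scalarE.
have iotaC c x : iota c * x = x * iota c by exact: algquot_scalarC.
have [||||||||||||||f [fZ fE fS fL]] := @zigB_lift n R A iota iotaC E S L.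
- exact: lift_vertexM.
- exact: lift_vertex_sum.
- exact: lift_sum0.
- by move=> j k; rewrite mulrDr !lift_vertex_arrow.
- by move=> j k; rewrite mulrDl !lift_arrow_vertex.
- by move=> h j k hk; rewrite lift_sumM /lift_arrow !zigA_mul0 ?addr0 //
  unfold_neq ?hk.
- move=> h j k jh jk; rewrite !lift_sumM.
  by congr (_ + _); apply: zigA_loopE; rewrite neighbours_unfold.
- by move=> j; rewrite -zigA_scalerAr mulrBr !lift_vertex_l !unfoldK eqxx.
- by move=> j; rewrite -zigA_scalerAl mulrBl !lift_vertex_r !unfoldK eqxx.
- by move=> j j0; rewrite /lift_ie (@unfold_first n false) // subrr scaler0.
- exact: lift_ieM.
- by move=> j k j0 k0; rewrite lift_ie_arrow // lift_arrow_ie.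
(* The product is i times the difference of the two loops at the middle vertex, through its upper
   and its lower neighbour; the type A relation there equates them. *)
- move=> v w v0 w1; rewrite lift_arrow_ie ?w1 // -zigA_scalerAl lift_diff_sum.
  have E := @unfold_first n false v v0.
  have vw t : neighbours (unfold t v, unfold t w).
    by rewrite neighbours_unfold /neighbours /= v0 w1.
  rewrite /lift_arrow (zigA_loopE R[i] (vw true) (k := unfold false w)) -?E //.
  by rewrite subrr scaler0.
(* Both products equal i times the difference of the loops at the upper and at the lower vertex over
   [w]. *)
- move=> v w v0 w1; rewrite -[RHS]mulrA lift_arrow_ie ?w1 // mulrA lift_ie_arrow
  ?w1 //.
  by rewrite -zigA_scalerAl -zigA_scalerAr lift_diff_sum lift_sum_diff.
by exists f; split=> // c x; rewrite fZ iotaE.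
Qed.

End BtoA.

(** * Invariance under the diagonal involution *)

Section Diag.
Variables (R : realType) (n : nat).
Local Notation m := (2 * n - 1)%N.

Lemma zigA_diagD x y :
  zigA_diag (x + y) = zigA_diag x + zigA_diag y :> zigA m R[i].
Proof. by rewrite /zigA_diag !rmorphD. Qed.

Lemma zigA_diagM x y :
  zigA_diag (x * y) = zigA_diag x * zigA_diag y :> zigA m R[i].
Proof. by rewrite /zigA_diag !rmorphM. Qed.

Lemma zigA_diagZ c x :
  zigA_diag (c *: x) = conjc c *: zigA_diag x :> zigA m R[i].
Proof. by rewrite /zigA_diag [zigA_conj _]zigA_coefZ linearZ. Qed.

Lemma zigA_diag_vertex v :
  zigA_diag (zigA_vertex R[i] v) = zigA_vertex R[i] (rev_ord v) :> zigA m R[i].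
Proof.
by rewrite /zigA_diag [zigA_conj _]zigA_coef_path [LHS]zigA_tau_vertex.
Qed.

Lemma zigA_diag_arrow v w : zigA_diag (zigA_arrow R[i] v w) =
  zigA_arrow R[i] (rev_ord v) (rev_ord w) :> zigA m R[i].
Proof.
by rewrite /zigA_diag [zigA_conj _]zigA_coefE arA_coef [LHS]zigA_tau_arrow.
Qed.

Lemma conjc_i : conjc 'i%C = - 'i%C :> R[i].
Proof. by apply/eqP; rewrite eq_complex /= oppr0 !eqxx. Qed.

(** The reflection exchanges the two sides, which fixes the symmetric images of vertices and arrows.
    In the image of [ie_j] it changes the sign, and so does the conjugation of i. *)
Lemma zigB_to_zigA_inv (f : {rmorphism zigB n R -> zigA m R[i]}) :
    (forall c x, f (c *: x) = (c%:C)%C *: f x) ->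
    (forall j, f (zigB_vertex R j) = lift_vertex R j) ->
    (forall j k, f (zigB_arrow R j k) = lift_sum R j k) ->
    (forall j, f (zigB_ie R j) = lift_ie R j) ->
  forall x, zigA_diag (f x) = f x.
Proof.
move=> fZ fE fS fL; apply: zigB_gen_ind.
- by rewrite rmorph0 /zigA_diag !rmorph0.
- by move=> x y xI yI; rewrite rmorphD zigA_diagD xI yI.
- by move=> x y xI yI; rewrite rmorphM zigA_diagM xI yI.
- by move=> c x xI; rewrite fZ zigA_diagZ xI [X in X *: _]conjc_real.
- move=> j; rewrite fE /lift_vertex sum_fold; case: eqP => j0.
    by rewrite zigA_diag_vertex unfold_rev (@unfold_first n (~~ true)).
  by rewrite zigA_diagD !zigA_diag_vertex !unfold_rev addrC.
- by move=> j k; rewrite fS zigA_diagD !zigA_diag_arrow !unfold_rev addrC.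
- move=> j; rewrite fL /lift_ie zigA_diagZ zigA_diagD -scaleN1r zigA_diagZ.
  rewrite !zigA_diag_vertex !unfold_rev conjc_i.
  by rewrite rmorphN1 !scaleN1r scaleNr -scalerN opprB.
Qed.
End Diag.

(** * From type A to type B *)

Section HalfIdempotent.
Variables (T : pzRingType) (i h e J : T).
Hypothesis iC : forall x, i * x = x * i.
Hypothesis hC : forall x, h * x = x * h.
Hypothesis ii : i * i = -1.
Hypothesis hh : h + h = 1.
Hypothesis ee : e * e = e.
Hypothesis eJ : e * J = J.
Hypothesis Je : J * e = J.
Hypothesis JJ : J * J = - e.

(** With [h] one half, this is the projection onto the eigenspace of [J] for the eigenvalue [i]; the
    complementary projection [e - p] belongs to [- i]. *)
Definition half_idem : T := h * (e - i * J).
Local Notation p := half_idem.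

Lemma half_idem_l : e * p = p.
Proof. by rewrite /p mulrA -hC -mulrA mulrBr ee mulrA -iC -mulrA eJ. Qed.

Lemma half_idem_r : p * e = p.
Proof. by rewrite /p -mulrA mulrBl ee -mulrA Je. Qed.

(** The element [i * J] squares to [e], hence [e - i * J] squares to twice itself, and [h] cancels
    the factor 2. *)
Lemma half_idemM : p * p = p.
Proof.
have iJ x : x * (i * J) = i * (x * J) by rewrite mulrA -iC mulrA.
have y2 : (e - i * J) * (e - i * J) = (e - i * J) + (e - i * J).
  rewrite mulrBl !mulrBr ee !iJ eJ -[i * J * e]mulrA Je -[i * J * J]mulrA JJ.
  by rewrite mulrA ii mulN1r opprK opprB -addrA [_ + (e - _)]addrC addrA.
rewrite /p -mulrA [X in h * X]mulrA -hC -mulrA y2.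
by rewrite mulrDr -mulrDl hh mul1r.
Qed.

(** The spectral decomposition of [J], with eigenvalues [i] and [- i]. *)
Lemma half_idem_J : i * (p - (e - p)) = J.
Proof.
rewrite opprB addrA -mulrDl hh mul1r addrAC subrr sub0r.
by rewrite mulrN mulrA ii mulN1r opprK.
Qed.

End HalfIdempotent.

(** * Images of the type A generators in the complexification *)

Section AtoB.
Variables (R : realType) (n : nat).
Local Notation m := (2 * n - 1)%N.
Local Notation B := (zigB n R).
Local Notation T := (complexification B).

Definition zigB_scalar : {rmorphism R -> B} :=
  @algquot_scalar _ _ (@zigB_rel n R).
Definition zigB_cplx_scalar : {rmorphism R[i] -> T} := cplx_scalar zigB_scalar.

Local Notation iota := zigB_cplx_scalar.

Lemma zigB_cplx_scalarC c (x : T) : iota c * x = x * iota c.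
Proof. by apply: cplx_scalarC => {}c {}x; apply: algquot_scalarC. Qed.

Definition cplx_vertex (j : 'I_n) : T := cplx_re (zigB_vertex R j).
Definition cplx_arrow (j k : 'I_n) : T := cplx_re (zigB_arrow R j k).
Definition cplx_ie (j : 'I_n) : T := cplx_re (zigB_ie R j).
Definition upper_idem (j : 'I_n) : T :=
  half_idem (iota 'i%C) (iota 2^-1) (cplx_vertex j) (cplx_ie j).
(** The first vertex carries no loop and is not split: both sides receive its whole idempotent. *)
Definition side_idem (s : bool) (j : 'I_n) : T :=
  if j == 0%N :> nat then cplx_vertex j
  else if s then upper_idem j else cplx_vertex j - upper_idem j.

Lemma cplx_vertexM j k :
  cplx_vertex j * cplx_vertex k = if j == k then cplx_vertex j else 0.
Proof. by rewrite -rmorphM zigB_vertexM; case: eqP => // _;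
  rewrite rmorph0. Qed.

Lemma cplx_vertex_arrow j k : cplx_vertex j * cplx_arrow j k = cplx_arrow j k.
Proof. by rewrite -rmorphM zigB_vertex_arrow. Qed.

Lemma cplx_arrow_vertex j k : cplx_arrow j k * cplx_vertex k = cplx_arrow j k.
Proof. by rewrite -rmorphM zigB_arrow_vertex. Qed.

Lemma iota_ii : iota 'i%C * iota 'i%C = -1.
Proof. by rewrite -rmorphM complex_ii rmorphN1. Qed.

Lemma iota_hh : iota 2^-1 + iota 2^-1 = 1.
Proof.
rewrite -rmorphD -[RHS](rmorph1 iota); congr (iota _).
by rewrite -mulr2n -(mulr_natr 2^-1) mulVf // Num.Theory.pnatr_eq0.
Qed.

Lemma cplx_vertex_ie j : cplx_vertex j * cplx_ie j = cplx_ie j.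
Proof. by rewrite -rmorphM zigB_vertex_ie. Qed.

Lemma cplx_ie_vertex j : cplx_ie j * cplx_vertex j = cplx_ie j.
Proof. by rewrite -rmorphM zigB_ie_vertex. Qed.

Lemma cplx_ieM (j : 'I_n) : (0 < j)%N ->
  cplx_ie j * cplx_ie j = - cplx_vertex j.
Proof. by move=> j0; rewrite -rmorphM zigB_ieM // rmorphN. Qed.

Lemma cplx_vertex_upper j : cplx_vertex j * upper_idem j = upper_idem j.
Proof. by apply: half_idem_l; rewrite ?cplx_vertexM ?eqxx ?cplx_vertex_ie // =>
  x; apply: zigB_cplx_scalarC. Qed.

Lemma upper_cplx_vertex j : upper_idem j * cplx_vertex j = upper_idem j.
Proof. by apply: half_idem_r; rewrite ?cplx_vertexM ?eqxx ?cplx_ie_vertex. Qed.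

Lemma upper_idemM (j : 'I_n) : (0 < j)%N ->
  upper_idem j * upper_idem j = upper_idem j.
Proof.
move=> j0; apply: half_idemM; rewrite ?cplx_vertexM ?eqxx ?cplx_vertex_ie
  ?cplx_ie_vertex ?cplx_ieM // ?iota_ii ?iota_hh //.
  exact: zigB_cplx_scalarC.
exact: zigB_cplx_scalarC.
Qed.

Lemma cplx_vertex_side s j : cplx_vertex j * side_idem s j = side_idem s j.
Proof.
by rewrite /side_idem; case: ifP => _; last case: s;
  rewrite ?mulrBr ?cplx_vertex_upper ?cplx_vertexM ?eqxx.
Qed.

Lemma side_cplx_vertex s j : side_idem s j * cplx_vertex j = side_idem s j.
Proof.
by rewrite /side_idem; case: ifP => _; last case: s;
  rewrite ?mulrBl ?upper_cplx_vertex ?cplx_vertexM ?eqxx.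
Qed.

Lemma side_idemM s j : side_idem s j * side_idem s j = side_idem s j.
Proof.
rewrite /side_idem; case: posnP => j0; first by rewrite cplx_vertexM eqxx.
case: s; rewrite ?upper_idemM // mulrBl !mulrBr cplx_vertexM eqxx
  cplx_vertex_upper upper_cplx_vertex upper_idemM //.
by rewrite subrr subr0.
Qed.

Lemma side_idem_ortho s t (j : 'I_n) : (0 < j)%N -> s != t ->
  side_idem s j * side_idem t j = 0.
Proof.
move=> j0; rewrite /side_idem (negbTE (lt0n_neq0 j0)).
by case: s t => [] [] // _; rewrite ?mulrBl ?mulrBr ?cplx_vertex_upper
  ?upper_cplx_vertex upper_idemM // subrr.
Qed.

(** Away from the first vertex the loops commute with the arrows, hence so do their
    eigenprojections. *)
Lemma upper_idem_arrow (j k : 'I_n) : (0 < j)%N -> (0 < k)%N ->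
  upper_idem j * cplx_arrow j k = cplx_arrow j k * upper_idem k.
Proof.
move=> j0 k0; rewrite /upper_idem /half_idem -mulrA mulrBl cplx_vertex_arrow
  -mulrA.
rewrite -[cplx_ie j * _]rmorphM zigB_ie_arrow // rmorphM.
rewrite [RHS]mulrA -zigB_cplx_scalarC -mulrA; congr (_ * _).
by rewrite mulrBr cplx_arrow_vertex [in RHS]mulrA -zigB_cplx_scalarC -mulrA.
Qed.

Lemma side_idem_arrow s (j k : 'I_n) : (0 < j)%N -> (0 < k)%N ->
  side_idem s j * cplx_arrow j k = cplx_arrow j k * side_idem s k.
Proof.
move=> j0 k0; rewrite /side_idem !(negbTE (lt0n_neq0 _)) //.
by case: s; rewrite ?mulrBl ?mulrBr ?cplx_vertex_arrow ?cplx_arrow_vertex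
  upper_idem_arrow.
Qed.

(* If [k] is the first vertex, then the idempotents do not commute with the
   arrows and the relation between ie_2 and X_2 is needed. *)
Lemma side_idem_loop s (j k : 'I_n) : (0 < j)%N ->
  side_idem s j * (cplx_arrow j k * cplx_arrow k j) =
    cplx_arrow j k * cplx_arrow k j * side_idem s j.
Proof.
move=> j0; case: (posnP k) => k0; last first.
  by rewrite mulrA side_idem_arrow // -[LHS]mulrA side_idem_arrow // mulrA.
have [jk|/zigB_arrow0 b0] := boolP (neighbours (j, k)); last first.
  by rewrite /cplx_arrow b0 rmorph0 !mul0r mulr0.
have j1 : j = 1%N :> nat by move: jk; rewrite /neighbours /= k0; lia.
have JX : cplx_ie j * (cplx_arrow j k * cplx_arrow k j) =
    cplx_arrow j k * cplx_arrow k j * cplx_ie j.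
  by rewrite -[cplx_arrow j k * _]rmorphM -[LHS]rmorphM -[RHS]rmorphM
    zigB_ie_X2E.
have pX : upper_idem j * (cplx_arrow j k * cplx_arrow k j) =
    cplx_arrow j k * cplx_arrow k j * upper_idem j.
  rewrite /upper_idem /half_idem -[LHS]mulrA mulrBl -[iota 'i%C * _ * _]mulrA
    JX.
  rewrite mulrA cplx_vertex_arrow [RHS]mulrA -zigB_cplx_scalarC -[RHS]mulrA;
    congr (_ * _).
  rewrite mulrBr -[cplx_arrow j k * cplx_arrow k j * cplx_vertex j]mulrA
    cplx_arrow_vertex.
  by rewrite [X in _ = _ - X]mulrA -zigB_cplx_scalarC -[X in _ = _ - X]mulrA.
rewrite /side_idem (negbTE (lt0n_neq0 j0)); case: s => //.
by rewrite mulrBl mulrBr pX mulrA cplx_vertex_arrow -[in RHS]mulrA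
  cplx_arrow_vertex.
Qed.

(** The two complementary idempotents at the second vertex differ by a multiple of [ie_2], and
    [(1|2) ie_2 (2|1) = 0]. *)
Lemma side_idem_first s t (j k : 'I_n) : j = 0%N :> nat -> k = 1%N :> nat ->
  cplx_arrow j k * side_idem s k * cplx_arrow k j =
  cplx_arrow j k * side_idem t k * cplx_arrow k j.
Proof.
move=> j0 k1.
have bJb : cplx_arrow j k * cplx_ie k * cplx_arrow k j = 0.
  by rewrite -[X in X * _]rmorphM -[LHS]rmorphM zigB_ie_firstE // rmorph0.
have bpb : cplx_arrow j k * upper_idem k * cplx_arrow k j =
    cplx_arrow j k * (cplx_vertex k - upper_idem k) * cplx_arrow k j.
  have JE : cplx_ie k =
      iota 'i%C * (upper_idem k - (cplx_vertex k - upper_idem k)).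
    rewrite /upper_idem half_idem_J //; [exact: iota_ii|exact: iota_hh].
  apply/eqP; rewrite -subr_eq0 -mulrBl -mulrBr.
  have -> : upper_idem k - (cplx_vertex k - upper_idem k) =
      - iota 'i%C * cplx_ie k.
    by rewrite JE mulrA mulNr iota_ii opprK mul1r.
  rewrite mulNr mulrN mulrA -zigB_cplx_scalarC -mulrA mulNr -mulrA bJb.
  by rewrite mulr0 oppr0.
by rewrite /side_idem k1; case: s t => [] [] //=.
Qed.

(* Images of e_v and (v|w) under g. *)
Definition fold_vertex (v : 'I_m) : T := side_idem (side v) (fold v).
(** Cutting at both ends treats all arrows alike: at the first vertex the idempotent does nothing,
    and between other vertices either of the two would suffice when [v] and [w] are adjacent. *)
Definition fold_arrow (v w : 'I_m) : T :=
  fold_vertex v * cplx_arrow (fold v) (fold w) * fold_vertex w.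

(** Vertices at different distances have orthogonal idempotents already in type B. At equal distance
    they lie on opposite sides and receive complementary idempotents. *)
Lemma fold_vertex_ortho v w : v != w -> fold_vertex v * fold_vertex w = 0.
Proof.
move=> vw; have [E|/negbTE jk] := eqVneq (fold v) (fold w); last first.
  by rewrite -[fold_vertex v]side_cplx_vertex -[fold_vertex w]cplx_vertex_side
    mulrA -[X in X * _]mulrA cplx_vertexM jk mulr0 mul0r.
have st : side v != side w.
  by apply: contraNneq vw => st; rewrite -(foldK v) -(foldK w) st E.
rewrite /fold_vertex E; apply: side_idem_ortho => //;
  case: (posnP (fold w)) => // w0.
by rewrite -(foldK v) -(foldK w) E !unfold_first ?eqxx in vw.
Qed.

Lemma fold_vertexM v w :
  fold_vertex v * fold_vertex w = if v == w then fold_vertex v else 0.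
Proof.
by case: eqP => [<-|/eqP]; [apply: side_idemM|apply: fold_vertex_ortho].
Qed.

Lemma sum_fold_vertex j : \sum_(v | fold v == j) fold_vertex v = cplx_vertex j.
Proof.
rewrite sum_fold /fold_vertex !unfoldK; case: (posnP j) => j0.
  by rewrite /side_idem j0 eqxx.
by rewrite !side_unfold // /side_idem (negbTE (lt0n_neq0 j0)) addrCA subrr
  addr0.
Qed.

Lemma fold_vertex_sum : \sum_v fold_vertex v = 1.
Proof.
rewrite (partition_big (@fold n) predT) //=.
under eq_bigr do rewrite sum_fold_vertex.
by rewrite -rmorph_sum zigB_vertex_sum rmorph1.
Qed.

Lemma fold_vertex_arrow v w : fold_vertex v * fold_arrow v w = fold_arrow v w.
Proof. by rewrite /fold_arrow !mulrA fold_vertexM eqxx. Qed.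

Lemma fold_arrow_vertex v w : fold_arrow v w * fold_vertex w = fold_arrow v w.
Proof. by rewrite /fold_arrow -!mulrA fold_vertexM eqxx. Qed.

(** If the folded vertices are adjacent but [v] and [w] are not, then neither is the middle vertex
    and they lie on opposite sides. Moving one idempotent past the arrow brings it next to its
    complement. *)
Lemma fold_arrow0 v w : ~~ neighbours (v, w) -> fold_arrow v w = 0.
Proof.
move=> vw; rewrite /fold_arrow.
have [jk|/zigB_arrow0] := boolP (neighbours (fold v, fold w)); last first.
  by rewrite /cplx_arrow => ->; rewrite rmorph0 mulr0 mul0r.
have [v0 w0] : (0 < fold v /\ 0 < fold w)%N.
  move: vw jk; rewrite /neighbours /=; case: (v) (w) => v' hv [w' hw] /=.
  by do 2!case: ifP => ?; lia.
have st : side v != side w.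
  apply: contraNneq vw => st.
  by rewrite -(foldK v) -(foldK w) st neighbours_unfold.
by rewrite [fold_vertex v * _]side_idem_arrow // -mulrA side_idem_ortho //
  mulr0.
Qed.

Lemma fold_vertex_cplx_arrow v w : neighbours (v, w) -> (0 < fold v)%N ->
  (0 < fold w)%N ->
  fold_vertex v * cplx_arrow (fold v) (fold w) =
    cplx_arrow (fold v) (fold w) * fold_vertex w.
Proof. by move=> vw v0 w0; rewrite /fold_vertex (neighbours_side vw) //
  side_idem_arrow. Qed.

Lemma neighboursC k (v w : 'I_k) : neighbours (v, w) = neighbours (w, v).
Proof. by rewrite /neighbours orbC. Qed.

(** Only the middle vertex has two neighbours at the same distance to it. *)
Lemma neighbours_fold_neq (v u w : 'I_m) : v != w ->
  neighbours (v, u) -> neighbours (u, w) -> (0 < fold u)%N -> fold v != fold w.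
Proof.
rewrite /neighbours -!(inj_eq val_inj) /=.
case: v u w => v hv [u hu] [w hw] /=.
by do ?case: ifP => ?; lia.
Qed.

Lemma neighbours_middle (v u w : 'I_m) : v != w ->
  neighbours (v, u) -> neighbours (u, w) ->
  (0 < fold u)%N -> fold v = 0%N :> nat -> (0 < fold w)%N.
Proof.
rewrite /neighbours -(inj_eq val_inj) /=.
case: v u w => v hv [u hu] [w hw] /=.
by do ?case: ifP => ?; lia.
Qed.

Lemma neighbours_of_middle (v u w : 'I_m) : v != w ->
  neighbours (v, u) -> neighbours (u, w) -> fold u = 0%N :> nat ->
  fold v = fold w /\ fold v = 1%N :> nat.
Proof.
move=> vw vu uw u0; split; first apply: val_inj; move: vw vu uw u0;
  rewrite /neighbours -(inj_eq val_inj) /=;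
  case: v u w => v hv [u hu] [w hw] /=;
  by do ?case: ifP => ?; lia.
Qed.

Lemma fold_arrow_mul0 v u w : v != w -> fold_arrow v u * fold_arrow u w = 0.
Proof.
move=> vw; have [vu|/fold_arrow0->] := boolP (neighbours (v, u));
  last by rewrite mul0r.
have [uw|/fold_arrow0->] := boolP (neighbours (u, w)); last by rewrite mulr0.
have bb : (0 < fold u)%N ->
    cplx_arrow (fold v) (fold u) * cplx_arrow (fold u) (fold w) = 0.
  move=> u0; rewrite -rmorphM zigB_mul0 ?rmorph0 //.
  exact: neighbours_fold_neq vw vu uw u0.
have -> : fold_arrow v u * fold_arrow u w =
    fold_vertex v * (cplx_arrow (fold v) (fold u) * fold_vertex u *
                     cplx_arrow (fold u) (fold w)) * fold_vertex w.
  by rewrite /fold_arrow !mulrA -[_ * fold_vertex u * fold_vertex u]mulrA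
    fold_vertexM eqxx.
(* If [u] is not the middle vertex, at most one of [v] and [w] is. The idempotent of [u] then moves
   outwards past the arrow joining it to the other one, and the type B arrows left adjacent multiply
   to 0. *)
case: (posnP (fold u)) => u0; last first.
  case: (posnP (fold v)) => v0; last first.
    by rewrite -fold_vertex_cplx_arrow //
      -[fold_vertex v * cplx_arrow _ _ * _]mulrA bb // !(mulr0, mul0r).
  have w0 : (0 < fold w)%N by apply: neighbours_middle vw vu uw u0 v0.
  by rewrite -[cplx_arrow _ _ * fold_vertex u * _]mulrA fold_vertex_cplx_arrow
    // [cplx_arrow _ _ * _]mulrA bb // !(mulr0, mul0r).
(* If [u] is the middle vertex, the type B product is [X_2], which need not vanish. It commutes with
   the idempotent of [v], which thus meets the orthogonal one of [w]. *)
have [vw1 fv0] := neighbours_of_middle vw vu uw u0.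
have EuE : fold_vertex u = cplx_vertex (fold u).
  by rewrite /fold_vertex /side_idem u0.
have EvX : fold_vertex v *
      (cplx_arrow (fold v) (fold u) * cplx_arrow (fold u) (fold w)) =
    cplx_arrow (fold v) (fold u) * cplx_arrow (fold u) (fold w) * fold_vertex v.
  by rewrite -vw1 /fold_vertex side_idem_loop // fv0.
by rewrite EuE cplx_arrow_vertex EvX -[LHS]mulrA fold_vertex_ortho // mulr0.
Qed.

(** The idempotent of [v] is absorbed, either by moving it to the left or because [v] is the middle
    vertex. The right copy of the idempotent of [u] commutes with the loop and merges with the left
    one. *)
Lemma fold_arrow_loop u v : neighbours (u, v) -> (0 < fold u)%N ->
  fold_arrow u v * fold_arrow v u = fold_vertex u *
    (cplx_arrow (fold u) (fold v) * cplx_arrow (fold v) (fold u)).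
Proof.
move=> uv u0.
have -> : fold_arrow u v * fold_arrow v u =
    fold_vertex u * (cplx_arrow (fold u) (fold v) * fold_vertex v *
                     cplx_arrow (fold v) (fold u)) * fold_vertex u.
  by rewrite /fold_arrow !mulrA -[_ * fold_vertex v * fold_vertex v]mulrA
    fold_vertexM eqxx.
have EX : fold_vertex u *
      (cplx_arrow (fold u) (fold v) * cplx_arrow (fold v) (fold u)) *
      fold_vertex u =
    fold_vertex u *
      (cplx_arrow (fold u) (fold v) * cplx_arrow (fold v) (fold u)).
  by rewrite -mulrA -side_idem_loop // [fold_vertex u * _]mulrA fold_vertexM
    eqxx.
case: (posnP (fold v)) => v0; first by rewrite {2}/fold_vertex /side_idem v0
  eqxx cplx_arrow_vertex EX.
by rewrite -fold_vertex_cplx_arrow // -[fold_vertex u * cplx_arrow _ _ * _]mulrA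
  [fold_vertex u * (fold_vertex u * _)]mulrA fold_vertexM eqxx EX.
Qed.

(** Away from the middle vertex this is the type B loop relation, cut by an idempotent. At the
    middle, [v] and [w] are the two vertices over the second vertex of type B, and the equality is
    [side_idem_first]. *)
Lemma fold_arrow_loopE v u w : neighbours (u, v) -> neighbours (u, w) ->
  fold_arrow u v * fold_arrow v u = fold_arrow u w * fold_arrow w u.
Proof.
have [->//|vw] := eqVneq v w => uv uw.
case: (posnP (fold u)) => u0; last first.
  rewrite !fold_arrow_loop //; congr (_ * _).
  have := zigB_loopE R (neighbours_fold uv) (neighbours_fold uw).
  by move/(congr1 (@cplx_re B)); rewrite !rmorphM.
have FF x : fold_arrow u x * fold_arrow x u =
    cplx_vertex (fold u) *
      (cplx_arrow (fold u) (fold x) * fold_vertex x *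
       cplx_arrow (fold x) (fold u)) * cplx_vertex (fold u).
  have EuE : fold_vertex u = cplx_vertex (fold u) by rewrite /fold_vertex
    /side_idem u0.
  by rewrite /fold_arrow EuE !mulrA -[_ * fold_vertex x * fold_vertex x]mulrA
    fold_vertexM eqxx.
rewrite !FF; congr (_ * _ * _).
have vu : neighbours (v, u) by rewrite neighboursC.
have [E fv1] := neighbours_of_middle vw vu uw u0.
rewrite /fold_vertex -!E; apply: side_idem_first => //.
Qed.

End AtoB.

(** * The isomorphism *)

Section Iso.
Variables (R : realType) (n : nat).
Local Notation m := (2 * n - 1)%N.
Local Notation A := (zigA m R[i]).
Local Notation B := (zigB n R).
Local Notation T := (complexification B).
Local Notation iota := (zigB_cplx_scalar R n).

Lemma zigA_to_zigB : exists g : {rmorphism A -> T},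
  [/\ forall c x, g (c *: x) = iota c * g x,
      forall v, g (zigA_vertex R[i] v) = fold_vertex R v
    & forall v w, g (zigA_arrow R[i] v w) = fold_arrow R v w].
Proof.
apply: zigA_lift.
- exact: zigB_cplx_scalarC.
- exact: fold_vertexM.
- exact: fold_vertex_sum.
- exact: fold_arrow0.
- exact: fold_vertex_arrow.
- exact: fold_arrow_vertex.
- exact: fold_arrow_mul0.
- by move=> v u w; apply: fold_arrow_loopE.
Qed.

Lemma fold_vertex_unfold s (j : 'I_n) :
  fold_vertex R (unfold s j) = side_idem R s j.
Proof.
rewrite /fold_vertex unfoldK; case: (posnP j) => j0;
  last by rewrite side_unfold.
by rewrite /side_idem j0.
Qed.

Lemma fold_arrow_unfoldl s (j k : 'I_n) : (0 < j)%N ->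
  fold_arrow R (unfold s j) (unfold s k) = side_idem R s j * cplx_arrow R j k.
Proof.
move=> j0; rewrite /fold_arrow !fold_vertex_unfold !unfoldK;
  case: (posnP k) => k0.
  by rewrite {2}/side_idem k0 -mulrA cplx_arrow_vertex.
by rewrite -mulrA -side_idem_arrow // mulrA side_idemM.
Qed.

Lemma fold_arrow_unfoldr s (j k : 'I_n) : (0 < k)%N ->
  fold_arrow R (unfold s j) (unfold s k) = cplx_arrow R j k * side_idem R s k.
Proof.
move=> k0; rewrite /fold_arrow !fold_vertex_unfold !unfoldK;
  case: (posnP j) => j0.
  by rewrite {1}/side_idem j0 cplx_vertex_arrow.
by rewrite side_idem_arrow // -mulrA side_idemM.
Qed.

Lemma side_idem_sum (j : 'I_n) : (0 < j)%N ->
  side_idem R true j + side_idem R false j = cplx_vertex R j.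
Proof. by move=> j0; rewrite /side_idem (negbTE (lt0n_neq0 j0)) addrCA subrr
  addr0. Qed.

(** At an end other than the first vertex the two idempotents add up to the vertex idempotent. If
    both ends are the first vertex, all terms are 0. *)
Lemma fold_arrow_sum (j k : 'I_n) :
  fold_arrow R (unfold true j) (unfold true k) +
  fold_arrow R (unfold false j) (unfold false k) = cplx_arrow R j k.
Proof.
case: (posnP j) => j0; last by rewrite !fold_arrow_unfoldl // -mulrDl
  side_idem_sum // cplx_vertex_arrow.
case: (posnP k) => k0; last by rewrite !fold_arrow_unfoldr // -mulrDr
  side_idem_sum // cplx_arrow_vertex.
have jk : ~~ neighbours (j, k) by rewrite /neighbours /= j0 k0.
by rewrite /cplx_arrow zigB_arrow0 // !fold_arrow0 ?neighbours_unfold // rmorph0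
  addr0.
Qed.

(** * The composites of the two maps *)

Section Inverse.
Variables (f : {rmorphism B -> A}) (g : {rmorphism A -> T}).
Hypothesis fZ : forall c x, f (c *: x) = (c%:C)%C *: f x.
Hypothesis fE : forall j, f (zigB_vertex R j) = lift_vertex R j.
Hypothesis fS : forall j k, f (zigB_arrow R j k) = lift_sum R j k.
Hypothesis fL : forall j, f (zigB_ie R j) = lift_ie R j.
Hypothesis gZ : forall c x, g (c *: x) = iota c * g x.
Hypothesis gE : forall v, g (zigA_vertex R[i] v) = fold_vertex R v.
Hypothesis gF : forall v w, g (zigA_arrow R[i] v w) = fold_arrow R v w.

Lemma zigA_to_zigBK x : g (f x) = cplx_re x.
Proof.
elim/zigB_gen_ind: x => [|x y IHx IHy|x y IHx IHy|c x IHx|j|j k|j].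
- by rewrite !rmorph0.
- by rewrite !rmorphD IHx IHy.
- by rewrite !rmorphM IHx IHy.
- rewrite fZ gZ IHx -[c *: x]algquot_scalarE rmorphM; congr (_ * _).
  by congr pair; rewrite /= raddf0.
- by rewrite fE /lift_vertex rmorph_sum -[RHS]sum_fold_vertex;
  apply: eq_bigr => v _.
- by rewrite fS rmorphD !gF fold_arrow_sum.
rewrite fL /lift_ie gZ rmorphB !gE !fold_vertex_unfold.
case: (posnP j) => j0; first by rewrite /side_idem j0 subrr mulr0 zigB_ie0 //
  rmorph0.
rewrite /side_idem (negbTE (lt0n_neq0 j0)) /upper_idem half_idem_J //.
  exact: iota_ii.
exact: iota_hh.
Qed.

Variable F : {rmorphism T -> A}.
Hypothesis FE : forall x, F x = f x.1 + algquot_scalar _ 'i%C * f x.2.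

Lemma cplx_ext_re x : F (cplx_re x) = f x.
Proof. by rewrite FE rmorph0 mulr0 addr0. Qed.

(** [F] is complex-linear, since it sends the scalar [c] to [Re c + i Im c]. *)
Lemma cplx_ext_scalar c x : F (iota c * x) = c *: F x.
Proof.
rewrite rmorphM -[RHS]algquot_scalarE; congr (_ * _); rewrite FE /=.
rewrite ![f (algquot_scalar _ _)]fZ rmorph1 algquot_scalarE.
rewrite scalerA -scalerDl; congr (_ *: _).
by rewrite [RHS]complexE.
Qed.

Lemma cplx_ext_side_idem s j :
  F (side_idem R s j) = zigA_vertex R[i] (unfold s j).
Proof.
have FeT : F (cplx_vertex R j) = lift_vertex R j by rewrite cplx_ext_re fE.
rewrite /side_idem; case: (posnP j) => j0.
  by rewrite FeT /lift_vertex sum_fold j0 /= (unfold_first s j0).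
(* With [u] and [l] the idempotents of the upper and lower vertex over [j], the image of
   [e_j - i ie_j] is [(u + l) + (u - l) = 2 u]. *)
have FpT : F (upper_idem R j) = zigA_vertex R[i] (unfold true j).
  rewrite /upper_idem /half_idem cplx_ext_scalar rmorphB cplx_ext_scalar FeT
    cplx_ext_re fL.
  rewrite /lift_ie scalerA complex_ii scaleN1r opprK /lift_vertex sum_fold.
  rewrite (negbTE (lt0n_neq0 j0)) addrACA subrr addr0 -mulr2n.
  by rewrite -[zigA_vertex _ _ *+ 2]scaler_nat scalerA mulVf ?scale1r //
    Num.Theory.pnatr_eq0.
case: s => //; rewrite rmorphB FeT FpT /lift_vertex sum_fold.
by rewrite (negbTE (lt0n_neq0 j0)) addrAC subrr add0r.
Qed.

Lemma cplx_ext_fold_vertex v : F (fold_vertex R v) = zigA_vertex R[i] v.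
Proof. by rewrite cplx_ext_side_idem foldK. Qed.

Lemma unfold_side (v w : 'I_m) : neighbours (v, w) -> (0 < fold v)%N ->
  unfold (side v) (fold w) = w.
Proof.
move=> vw v0; rewrite -[RHS]foldK; case: (posnP (fold w)) => w0.
  by rewrite !unfold_first.
by rewrite (neighbours_side vw).
Qed.

(** The image is the sum of the two lifts of the folded arrow, cut by the idempotents of [v] and
    [w]. At an end other than the middle vertex, the idempotent selects the lift on its own side,
    which is the arrow from [v] to [w]. *)
Lemma cplx_ext_fold_arrow v w : F (fold_arrow R v w) = zigA_arrow R[i] v w.
Proof.
have [vw|nvw] := boolP (neighbours (v, w)); last first.
  by rewrite fold_arrow0 // rmorph0 zigA_arrow0.
rewrite !rmorphM !cplx_ext_fold_vertex cplx_ext_re fS.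
case: (posnP (fold v)) => v0; last first.
  have vE t : zigA_vertex R[i] v * lift_arrow R t (fold v) (fold w) =
      if side v == t then lift_arrow R t (fold v) (fold w) else 0.
    by rewrite -[X in zigA_vertex _ X]foldK unfold_vertex_arrow.
  rewrite mulrDr !vE (_ : _ + _ = zigA_arrow R[i] v w) ?zigA_arrow_vertex //.
  have <- : lift_arrow R (side v) (fold v) (fold w) = zigA_arrow R[i] v w.
    by rewrite /lift_arrow foldK unfold_side.
  by case: (side v); rewrite /= ?addr0 ?add0r.
case: (posnP (fold w)) => w0; last first.
  have wv : neighbours (w, v) by rewrite neighboursC.
  have wE t : lift_arrow R t (fold v) (fold w) * zigA_vertex R[i] w =
      if side w == t then lift_arrow R t (fold v) (fold w) else 0.
    by rewrite -[X in zigA_vertex _ X]foldK unfold_arrow_vertex.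
  rewrite -mulrA mulrDl !wE (_ : _ + _ = zigA_arrow R[i] v w) ?zigA_vertex_arrow
    //.
  have <- : lift_arrow R (side w) (fold v) (fold w) = zigA_arrow R[i] v w.
    by rewrite /lift_arrow foldK unfold_side.
  by case: (side w); rewrite /= ?addr0 ?add0r.
by have := neighbours_fold vw; rewrite /neighbours [(_, _).1]/= [(_, _).2]/= v0
  w0.
Qed.

Lemma zigB_to_zigAK x : F (g x) = x.
Proof.
elim/zigA_gen_ind: x => [|x y IHx IHy|x y IHx IHy|c x IHx|v|v w].
- by rewrite !rmorph0.
- by rewrite !rmorphD IHx IHy.
- by rewrite !rmorphM IHx IHy.
- by rewrite gZ cplx_ext_scalar IHx.
- by rewrite gE cplx_ext_fold_vertex.
- by rewrite gF cplx_ext_fold_arrow.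
Qed.

Lemma zigB_to_zigA_inv_surj x : zigA_diag x = x -> f (g x).1 = x :> A.
Proof.
move=> xI; have fI := zigB_to_zigA_inv fZ fE fS fL.
have xE : x = f (g x).1 + 'i%C *: f (g x).2.
  by rewrite -[LHS]zigB_to_zigAK FE algquot_scalarE.
have xE' : x = f (g x).1 - 'i%C *: f (g x).2.
  rewrite -[LHS]xI [in LHS]xE zigA_diagD zigA_diagZ !fI.
  by rewrite conjc_i scaleNr.
(* Adding the two expressions for [x] cancels the imaginary part, and 2 is invertible. *)
have x2 : (2%:R : R[i]) *: x = 2%:R *: f (g x).1.
  have := congr2 +%R xE xE'; rewrite addrACA subrr addr0.
  by rewrite !scaler_nat !mulr2n.
have u2 : (2%:R : R[i]) != 0 by rewrite Num.Theory.pnatr_eq0.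
by rewrite -[LHS]scale1r -[RHS]scale1r -(mulVf u2) -!scalerA x2.
Qed.

End Inverse.

End Iso.

Theorem theorem0p0p2 (R : realType) (n : nat) (hn : (2 <= n)%N) :
  exists f : zigB n R -> zigA_inv R (2 * n - 1),
    [/\ linear f, monoid_morphism f & bijective f].
Proof.
have [f [fZ fE fS fL]] := zigB_to_zigA R n.
have [g [gZ gE gF]] := zigA_to_zigB R n.
pose i : zigA (2 * n - 1) R[i] := algquot_scalar _ 'i%C.
have ii : i * i = -1.
  by rewrite -rmorphM complex_ii rmorphN1.
have iC x : i * x = x * i by exact: algquot_scalarC.
have [F FE] := cplx_ext_rmorphism f ii iC.
have fI x : (f x : zigA_real R (2 * n - 1)) \in @zigA_invariant R (2 * n - 1).
  by apply/zigA_invariantP/zigB_to_zigA_inv.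
exists (fun x => ZigAInv (fI x)); split.
- by move=> c x y; apply: val_inj => /=; rewrite rmorphD fZ.
- split=> [|x y]; apply: val_inj => /=; first by rewrite rmorph1.
  by rewrite rmorphM.
(* The inverse takes the real part of [g], its first component in the complexification. *)
exists (fun x => (g (zigA_inv_val x)).1) => [x|x] /=.
  by rewrite (zigA_to_zigBK fZ fE fS fL gZ gE gF).
apply: val_inj => /=; apply: (zigB_to_zigA_inv_surj fZ fE fS fL gZ gE gF FE).
exact/zigA_invariantP/(zigA_inv_prop x).
Qed.
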